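(* Let $E$ be an arbitrary directed graph, $K$ a field and $L=L_K(E)$. Then the graded socle $Soc^{gr}(L)$ is the two-sided ideal of $L$ generated by the set consisting of all the line points and all the Laurent vertices in $E$, and there is a graded isomorphism $$Soc^{gr}(L)\;\cong_{gr}\;\bigoplus_{v_i\in X} M_{\Lambda_i}(K)(|\overline{p^{v_i}}|)\;\oplus\;\bigoplus_{c_j\in Y} M_{\Upsilon_j}(K[x^{t_j},x^{-t_j}])(|\overline{q^{w_j}}|),$$ where $\Lambda_i,\Upsilon_j$ are suitable index sets, the $t_j$ are positive integers, $X$ is the set of representatives of the distinct equivalence classes of line points in $E$, and $Y$ is the set of all distinct cycles (without exits) in $E$. Here, for each $v_i\in X$, $\overline{p^{v_i}}=\{p_s^{v_i}: s\in\Lambda_i\}$ is the set of all paths in $E$ that end at $v_i$ and $|\overline{p^{v_i}}|=(|p_s^{v_i}|)_{s\in\Lambda_i}$ is the family of their lengths; for each cycle $c_j\in Y$, based at a vertex $w_j$, $\overline{q^{w_j}}=\{q_r^{w_j}: r\in\Upsilon_j\}$ is the set of all paths in $E$ that end at $w_j$ and do not include all the edges of $c_j$, and $|\overline{q^{w_j}}|=(|q_r^{w_j}|)_{r\in\Upsilon_j}$ is the family of their lengths. The index sets may be infinite.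
   Context: A directed graph $E=(E^0,E^1,r,s)$ has vertex set $E^0$, edge set $E^1$ and range/source maps $r,s:E^1\to E^0$; no cardinality restriction is made. A path of length $n>0$ is a sequence of edges $\mu=e_1\cdots e_n$ with $r(e_i)=s(e_{i+1})$; vertices are paths of length $0$; $|\mu|$ is the length. A vertex is regular if it emits a nonempty finite set of edges. $L_K(E)$ is the (not necessarily unital) $K$-algebra generated by pairwise orthogonal idempotents $v\in E^0$ and elements $e,e^*$ ($e\in E^1$) subject to: $s(e)e=e=er(e)$; $r(e)e^*=e^*=e^*s(e)$; $e^*e=r(e)$ and $e^*f=0$ for edges $e\ne f$; $v=\sum_{s(e)=v}ee^*$ for each regular vertex $v$. It is $\mathbb{Z}$-graded by $\deg v=0$, $\deg e=1$, $\deg e^*=-1$. A cycle is a closed path $e_1\cdots e_n$ ($n\geq 1$, $r(e_n)=s(e_1)$) with $s(e_i)\ne s(e_j)$ for $i\neq j$; cycles differing only by the choice of base vertex are counted as one. An exit of a path $e_1\cdots e_n$ is an edge $f$ with $s(f)=s(e_i)$ and $f\ne e_i$ for some $i$. For a vertex $v$, $T_E(v)$ is the set of vertices $w$ such that there is a path from $v$ to $w$. A bifurcation vertex is a vertex emitting more than one edge. A vertex $v$ is a line point if no vertex of $T_E(v)$ is a bifurcation vertex or the base of a cycle. A vertex $v$ is a Laurent vertex if $T_E(v)$ is the set of all vertices on a single path $\gamma=\mu c$, where $\mu$ is a path without bifurcations starting at $v$ and $c$ is a cycle without exits based at $r(\mu)$. Two line points $u,v$ are equivalent if $T_E(u)\cap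 T_E(v)\ne\emptyset$. $Soc^{gr}(L)$ is the sum of all minimal graded left ideals of $L$. For a $\mathbb{Z}$-graded ring $A$, a set $I$ and integers $\bar\delta=(\delta_i)_{i\in I}$, $M_I(A)(\bar\delta)$ is the ring of $I\times I$ matrices over $A$ with only finitely many nonzero entries, graded by $\deg(e_{ij}(a))=\deg(a)+\delta_i-\delta_j$ for homogeneous $a\in A$, where $e_{ij}(a)$ has $a$ in position $(i,j)$ and zeros elsewhere. $K$ is concentrated in degree $0$, and $K[x^t,x^{-t}]$ is graded as a subring of $K[x,x^{-1}]$ with $\deg x=1$.
   Formalization: Instead of all paths ending at v_i with their lengths (false e.g. for an infinite line), Λ_i consists of the paths p that stop where they first meet T_E(v_i), with degree |p| minus the length of the path from v_i to the end of p; for a sink v_i this is the stated family. *)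

(* Defs.v *)
From HB Require Import structures.
From mathcomp Require Import all_boot all_order all_algebra finmap.
From mathcomp Require Import boolp classical_sets functions cardinality fsbigop.

Set Implicit Arguments.
Unset Strict Implicit.
Unset Printing Implicit Defensive.

Import GRing.Theory.

Local Open Scope classical_set_scope.
Local Open Scope quotient_scope.
Local Open Scope ring_scope.

HB.mixin Record Lmodule_isNonUnitalAlgebra (K : fieldType) A
    of GRing.Lmodule K A := {
  amul : A -> A -> A;
  amulA : associative amul;
  amulDl : left_distributive amul +%R;
  amulDr : right_distributive amul +%R;
  amulZl : forall k x y, amul (k *: x) y = k *: amul x y;
  amulZr : forall k x y, amul x (k *: y) = k *: amul x y }.

#[short(type="nualgType")]
HB.structure Definition NonUnitalAlgebra (K : fieldType) :=
  {A of GRing.Lmodule K A & Lmodule_isNonUnitalAlgebra K A}.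

Section NonUnitalTheory.
Variables (K : fieldType) (A : nualgType K).
Implicit Types x y : A.

Lemma amul0x x : amul 0 x = 0.
Proof. by have := amulZl (0 : K) (0 : A) x; rewrite !scale0r. Qed.

Lemma amulx0 x : amul x 0 = 0.
Proof. by have := amulZr (0 : K) x (0 : A); rewrite !scale0r. Qed.

Lemma amul_suml (J : Type) (r : seq J) (F : J -> A) x :
  amul (\sum_(j <- r) F j) x = \sum_(j <- r) amul (F j) x.
Proof.
elim: r => [|j r IH]; first by rewrite !big_nil amul0x.
by rewrite !big_cons amulDl IH.
Qed.

Lemma amul_sumr (J : Type) (r : seq J) (F : J -> A) x :
  amul x (\sum_(j <- r) F j) = \sum_(j <- r) amul x (F j).
Proof.
elim: r => [|j r IH]; first by rewrite !big_nil amulx0.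
by rewrite !big_cons amulDr IH.
Qed.

End NonUnitalTheory.

HB.instance Definition _ (K : fieldType) :=
  Lmodule_isNonUnitalAlgebra.Build K K^o (@mulrA K) (@mulrDl K) (@mulrDr K)
    (fun k x y => esym (mulrA k x y)) (fun k x y => mulrCA x k y).

Section ProdAlgebra.
Variables (K : fieldType) (A B : nualgType K).

Let pmul (x y : A * B) : A * B := (amul x.1 y.1, amul x.2 y.2).

Fact pmulA : associative pmul.
Proof. by move=> x y z; rewrite /pmul /= !amulA. Qed.
Fact pmulDl : left_distributive pmul +%R.
Proof. by move=> x y z; rewrite /pmul /= !amulDl. Qed.
Fact pmulDr : right_distributive pmul +%R.
Proof. by move=> x y z; rewrite /pmul /= !amulDr. Qed.
Fact pmulZl k x y : pmul (k *: x) y = k *: pmul x y.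
Proof. by rewrite /pmul /= !amulZl. Qed.
Fact pmulZr k x y : pmul x (k *: y) = k *: pmul x y.
Proof. by rewrite /pmul /= !amulZr. Qed.

HB.instance Definition _ :=
  Lmodule_isNonUnitalAlgebra.Build K (A * B)%type
    pmulA pmulDl pmulDr pmulZl pmulZr.

End ProdAlgebra.

Record dsum (K : fieldType) (I : choiceType) (V : I -> lmodType K) := DSum {
  dval :> forall i, V i;
  dval_finite : finite_set [set i | dval i != 0] }.

Section DSum.
Variables (K : fieldType) (I : choiceType) (V : I -> lmodType K).
Local Notation D := (dsum V).

HB.instance Definition _ := gen_eqMixin D.
HB.instance Definition _ := gen_choiceMixin D.

Lemma dsumP (f g : D) : (forall i, f i = g i) -> f = g.
Proof.
case: f g => [f ff] [g gf] /= fg; have {}fg : f = g by exact: functional_extensionality_dep.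
by move: ff gf; rewrite fg => ff gf; rewrite (Prop_irrelevance ff gf).
Qed.

Definition dsupp (f : D) : {fset I} := fset_set [set i | f i != 0].

Lemma dsuppPn (f : D) i : i \notin dsupp f -> f i = 0.
Proof.
rewrite in_fset_set; last exact: dval_finite.
by rewrite notin_setE /= => /negP; rewrite negbK => /eqP.
Qed.

Fact fsupp_finite (S : {fset I}) (F : forall i, V i) :
  (forall i, i \notin S -> F i = 0) -> finite_set [set i | F i != 0].
Proof.
by move=> F0; apply: (finite_subfset S) => i /=; apply: contra_neqT => /F0.
Qed.

Definition mk_dsum S F (F0 : forall i, i \notin S -> F i = 0) : D :=
  DSum (fsupp_finite F0).

Fact dsum0_subproof i : i \notin (fset0 : {fset I}) -> (0 : V i) = 0.
Proof. by []. Qed.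
Definition dsum0 : D := mk_dsum dsum0_subproof.

Fact dsumN_subproof (f : D) i : i \notin dsupp f -> - f i = 0.
Proof. by move=> /dsuppPn ->; rewrite oppr0. Qed.
Definition dsumN (f : D) : D := mk_dsum (dsumN_subproof (f := f)).

Fact dsumD_subproof (f g : D) i :
  i \notin (dsupp f `|` dsupp g)%fset -> f i + g i = 0.
Proof.
by rewrite in_fsetU negb_or => /andP[/dsuppPn -> /dsuppPn ->]; rewrite addr0.
Qed.
Definition dsumD (f g : D) : D := mk_dsum (dsumD_subproof (f := f) (g := g)).

Fact dsumZ_subproof k (f : D) i : i \notin dsupp f -> k *: f i = 0.
Proof. by move=> /dsuppPn ->; rewrite scaler0. Qed.
Definition dsumZ k (f : D) : D := mk_dsum (dsumZ_subproof k (f := f)).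

Fact dsumDA : associative dsumD.
Proof. by move=> f g h; apply: dsumP => i /=; rewrite addrA. Qed.
Fact dsumDC : commutative dsumD.
Proof. by move=> f g; apply: dsumP => i /=; rewrite addrC. Qed.
Fact dsum0D : left_id dsum0 dsumD.
Proof. by move=> f; apply: dsumP => i /=; rewrite add0r. Qed.
Fact dsumND : left_inverse dsum0 dsumN dsumD.
Proof. by move=> f; apply: dsumP => i /=; rewrite addNr. Qed.

HB.instance Definition _ := GRing.isZmodule.Build D dsumDA dsumDC dsum0D dsumND.

Fact dsumZA a b f : dsumZ a (dsumZ b f) = dsumZ (a * b) f.
Proof. by apply: dsumP => i /=; rewrite scalerA. Qed.
Fact dsumZ1 : left_id 1 dsumZ.
Proof. by move=> f; apply: dsumP => i /=; rewrite scale1r. Qed.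
Fact dsumZDr : right_distributive dsumZ +%R.
Proof. by move=> a f g; apply: dsumP => i /=; rewrite scalerDr. Qed.
Fact dsumZDl f : {morph dsumZ^~ f : a b / a + b}.
Proof. by move=> a b; apply: dsumP => i /=; rewrite scalerDl. Qed.

HB.instance Definition _ :=
  GRing.Zmodule_isLmodule.Build K D dsumZA dsumZ1 dsumZDr dsumZDl.

Lemma dsumDE (f g : D) i : (f + g) i = f i + g i. Proof. by []. Qed.
Lemma dsumZE k (f : D) i : (k *: f) i = k *: f i. Proof. by []. Qed.

End DSum.

Definition dirsum (K : fieldType) (I : choiceType) (A : I -> nualgType K) :=
  dsum (fun i => A i : lmodType K).

Section DirSum.
Variables (K : fieldType) (I : choiceType) (A : I -> nualgType K).
Local Notation D := (dirsum A).

HB.instance Definition _ := GRing.Lmodule.on D.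

Fact dirsum_mul_subproof (f g : D) i : i \notin dsupp f -> amul (f i) (g i) = 0.
Proof. by move=> /dsuppPn ->; rewrite amul0x. Qed.
Definition dirsum_mul (f g : D) : D :=
  mk_dsum (dirsum_mul_subproof (f := f) g).

Fact dirsum_mulA : associative dirsum_mul.
Proof. by move=> f g h; apply: dsumP => i /=; rewrite amulA. Qed.
Fact dirsum_mulDl : left_distributive dirsum_mul +%R.
Proof. by move=> f g h; apply: dsumP => i /=; rewrite amulDl. Qed.
Fact dirsum_mulDr : right_distributive dirsum_mul +%R.
Proof. by move=> f g h; apply: dsumP => i /=; rewrite amulDr. Qed.
Fact dirsum_mulZl k f g : dirsum_mul (k *: f) g = k *: dirsum_mul f g.
Proof. by apply: dsumP => i /=; rewrite amulZl. Qed.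
Fact dirsum_mulZr k f g : dirsum_mul f (k *: g) = k *: dirsum_mul f g.
Proof. by apply: dsumP => i /=; rewrite amulZr. Qed.

HB.instance Definition _ :=
  Lmodule_isNonUnitalAlgebra.Build K D
    dirsum_mulA dirsum_mulDl dirsum_mulDr dirsum_mulZl dirsum_mulZr.

End DirSum.

Definition fmatrix (K : fieldType) (I : choiceType) (A : nualgType K) :=
  dsum (fun _ : I * I => A : lmodType K).

Section FMatrix.
Variables (K : fieldType) (I : choiceType) (A : nualgType K).
Local Notation M := (fmatrix I A).
Implicit Types m n p : M.

HB.instance Definition _ := GRing.Lmodule.on M.

Definition mrows m : {fset I} := [fset ij.1 | ij in dsupp m]%fset.
Definition mcols m : {fset I} := [fset ij.2 | ij in dsupp m]%fset.

Lemma mrowsPn m i j : i \notin mrows m -> m (i, j) = 0.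
Proof.
by move=> iN; apply: dsuppPn; apply: contra iN => ?; apply/imfsetP; exists (i, j).
Qed.

Lemma mcolsPn m i j : j \notin mcols m -> m (i, j) = 0.
Proof.
by move=> jN; apply: dsuppPn; apply: contra jN => ?; apply/imfsetP; exists (i, j).
Qed.

Definition fmatrix_mulE m n (ij : I * I) : A :=
  \sum_(k \in [set: I]) amul (m (ij.1, k)) (n (k, ij.2)).

Lemma fmatrix_mul_cols m n ij (S : {fset I}) : {subset mcols m <= S} ->
  fmatrix_mulE m n ij = \sum_(k <- S) amul (m (ij.1, k)) (n (k, ij.2)).
Proof.
move=> mS; apply: fsbigTE => k kS.
by rewrite mcolsPn ?amul0x//; apply: contra kS => /mS.
Qed.

Lemma fmatrix_mul_rows m n ij (S : {fset I}) : {subset mrows n <= S} ->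
  fmatrix_mulE m n ij = \sum_(k <- S) amul (m (ij.1, k)) (n (k, ij.2)).
Proof.
move=> mS; apply: fsbigTE => k kS.
by rewrite (mrowsPn (m := n)) ?amulx0//; apply: contra kS => /mS.
Qed.

Fact fmatrix_mul_subproof m n ij :
  ij \notin (mrows m `*` mcols n)%fset ->
  fmatrix_mulE m n ij = 0.
Proof.
case: ij => i j ijN; rewrite (fmatrix_mul_cols _ _ (S := mcols m))//.
rewrite big1// => k _ /=.
have [im|iN] := boolP (i \in mrows m); last by rewrite mrowsPn ?amul0x.
have [jn|jN] := boolP (j \in mcols n); last by rewrite (mcolsPn _ jN) amulx0.
by case/negP: ijN; rewrite in_fsetM im jn.
Qed.

Definition fmatrix_mul m n : M := mk_dsum (fmatrix_mul_subproof (m := m) (n := n)).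

Fact fmatrix_mulA : associative fmatrix_mul.
Proof.
move=> m n p; apply: dsumP => -[i j] /=.
rewrite (fmatrix_mul_cols _ _ (S := mcols m))//=.
rewrite (fmatrix_mul_rows _ _ (S := mrows p))//=.
under [RHS]eq_bigr do rewrite (fmatrix_mul_cols _ _ (S := mcols m))//= amul_suml.
rewrite [RHS]exchange_big /=; apply: eq_bigr => k _.
rewrite (fmatrix_mul_rows _ _ (S := mrows p))//= amul_sumr.
by apply: eq_bigr => l _; rewrite amulA.
Qed.

Fact fmatrix_mulDl : left_distributive fmatrix_mul +%R.
Proof.
move=> m n p; apply: dsumP => ij; rewrite dsumDE /=.
rewrite !(fmatrix_mul_rows _ _ (S := mrows p))// -big_split /=.
by apply: eq_bigr => k _; rewrite amulDl.
Qed.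

Fact fmatrix_mulDr : right_distributive fmatrix_mul +%R.
Proof.
move=> p m n; apply: dsumP => ij; rewrite dsumDE /=.
rewrite !(fmatrix_mul_cols _ _ (S := mcols p))// -big_split /=.
by apply: eq_bigr => k _; rewrite amulDr.
Qed.

Fact fmatrix_mulZl k m n : fmatrix_mul (k *: m) n = k *: fmatrix_mul m n.
Proof.
apply: dsumP => ij; rewrite dsumZE /=.
rewrite !(fmatrix_mul_rows _ _ (S := mrows n))// scaler_sumr.
by apply: eq_bigr => l _; rewrite amulZl.
Qed.

Fact fmatrix_mulZr k m n : fmatrix_mul m (k *: n) = k *: fmatrix_mul m n.
Proof.
apply: dsumP => ij; rewrite dsumZE /=.
rewrite !(fmatrix_mul_cols _ _ (S := mcols m))// scaler_sumr.
by apply: eq_bigr => l _; rewrite amulZr.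
Qed.

HB.instance Definition _ :=
  Lmodule_isNonUnitalAlgebra.Build K M
    fmatrix_mulA fmatrix_mulDl fmatrix_mulDr fmatrix_mulZl fmatrix_mulZr.

End FMatrix.

Arguments fmatrix {K} I A.

(* The family (a_k) stands for \sum_k a_k x^(t k) in K[x^t, x^-t]; the algebra
   does not depend on t > 0, but its grading laurent_homog does. *)
Definition laurent (K : fieldType) (t : nat) := dsum (fun _ : int => K^o : lmodType K).

Section Laurent.
Variables (K : fieldType) (t : nat).
Local Notation L := (laurent K t).
Implicit Types f g h : L.

HB.instance Definition _ := GRing.Lmodule.on L.

Definition laurent_mulE f g (n : int) : K :=
  \sum_(k \in [set: int]) (f k : K) * g (n - k).

Lemma laurent_mul_left f g n (S : {fset int}) : {subset dsupp f <= S} ->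
  laurent_mulE f g n = \sum_(k <- S) (f k : K) * g (n - k).
Proof.
move=> fS; apply: fsbigTE => k kS.
by rewrite dsuppPn ?mul0r//; apply: contra kS => /fS.
Qed.

Lemma laurent_mul_right f g n m (S : {fset int}) :
    {subset [fset (n - k)%R | k in dsupp g]%fset <= S} ->
  laurent_mulE f g (n - m) = \sum_(k <- S) (f (k - m) : K) * g (n - k).
Proof.
move=> gS; rewrite /laurent_mulE (reindex_fsbigT (fun k : int => k - m)); last first.
  by exists (fun k => k + m) => k; rewrite ?subrK ?addrK.
rewrite (fsbigTE S) => [|k kS].
  by apply: eq_bigr => k _; rewrite opprB addrA subrK.
rewrite opprB addrA subrK (_ : g (n - k) = 0) ?mulr0//.
apply: dsuppPn; apply: contra kS => kg; apply: gS; apply/imfsetP.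
by exists (n - k) => //=; rewrite opprB addrC subrK.
Qed.

Fact laurent_mul_subproof f g n :
  n \notin [fset (xy.1 + xy.2)%R | xy in (dsupp f `*` dsupp g)%fset]%fset ->
  (laurent_mulE f g n : K^o) = 0.
Proof.
move=> nN; rewrite (laurent_mul_left _ _ (S := dsupp f))//.
rewrite big_seq big1// => k kf.
rewrite (_ : g (n - k) = 0) ?mulr0//; apply: dsuppPn; apply: contra nN => gnk.
by apply/imfsetP; exists (k, n - k); rewrite ?in_fsetM /= ?kf// addrC subrK.
Qed.

Definition laurent_mul f g : L := mk_dsum (laurent_mul_subproof (f := f) (g := g)).

Fact laurent_mulA : associative laurent_mul.
Proof.
move=> f g h; apply: dsumP => n /=.
pose S := [fset (n - k)%R | k in dsupp h]%fset.
rewrite (laurent_mul_left _ _ (S := dsupp f))//=.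
rewrite -[n in RHS]subr0 (@laurent_mul_right (laurent_mul f g) h n 0 S)//=.
under [RHS]eq_bigr do
  rewrite subr0 (laurent_mul_left _ _ (S := dsupp f))//= mulr_suml.
rewrite [RHS]exchange_big /=; apply: eq_bigr => k _.
rewrite (@laurent_mul_right g h n k S)//= mulr_sumr.
by apply: eq_bigr => l _; rewrite mulrA.
Qed.

Fact laurent_mulDl : left_distributive laurent_mul +%R.
Proof.
move=> f g h; apply: dsumP => n; rewrite dsumDE /=.
rewrite !(@laurent_mul_left _ _ _ (dsupp f `|` dsupp g `|` dsupp (f + g)%R)%fset);
  try by move=> x xs; rewrite !in_fsetU xs ?orbT.
by rewrite -big_split /=; apply: eq_bigr => k _; rewrite mulrDl.
Qed.

Fact laurent_mulDr : right_distributive laurent_mul +%R.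
Proof.
move=> h f g; apply: dsumP => n; rewrite dsumDE /=.
rewrite !(laurent_mul_left _ _ (S := dsupp h))// -big_split /=.
by apply: eq_bigr => k _; rewrite mulrDr.
Qed.

Fact laurent_mulZl k f g : laurent_mul (k *: f) g = k *: laurent_mul f g.
Proof.
apply: dsumP => n; rewrite dsumZE /=.
rewrite !(@laurent_mul_left _ _ _ (dsupp f `|` dsupp (k *: f)%R)%fset);
  try by move=> x xs; rewrite !in_fsetU xs ?orbT.
by rewrite scaler_sumr; apply: eq_bigr => l _; exact: esym (mulrA _ _ _).
Qed.

Fact laurent_mulZr k f g : laurent_mul f (k *: g) = k *: laurent_mul f g.
Proof.
apply: dsumP => n; rewrite dsumZE /=.
rewrite !(laurent_mul_left _ _ (S := dsupp f))// scaler_sumr.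
by apply: eq_bigr => l _; exact: mulrCA.
Qed.

HB.instance Definition _ :=
  Lmodule_isNonUnitalAlgebra.Build K L
    laurent_mulA laurent_mulDl laurent_mulDr laurent_mulZl laurent_mulZr.

End Laurent.

Definition grading (A : Type) := int -> set A.

Definition scalar_homog (K : fieldType) : grading K^o :=
  fun n => [set a | n != 0 -> a = 0].

Definition laurent_homog (K : fieldType) (t : nat) : grading (laurent K t) :=
  fun n => [set f | forall k : int, f k != 0 -> t%:Z * k = n].

Definition fmatrix_homog (K : fieldType) (I : choiceType) (A : nualgType K)
    (GA : grading A) (d : I -> int) : grading (fmatrix I A) :=
  fun n => [set m | forall i j, GA (n - d i + d j) (m (i, j))].

Definition dirsum_homog (K : fieldType) (I : choiceType) (A : I -> nualgType K)
    (GA : forall i, grading (A i)) : grading (dirsum A) :=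
  fun n => [set f | forall i, GA i n (f i)].

Definition prod_homog (A B : Type) (GA : grading A) (GB : grading B) :
    grading (A * B) :=
  fun n => [set x | GA n x.1 /\ GB n x.2].

(* S is meant to be an ideal of A; its graded isomorphism with B is given as an
   embedding of B in A with image S. *)
Definition graded_iso (K : fieldType) (A B : nualgType K)
    (GA : grading A) (S : set A) (GB : grading B) : Prop :=
  exists phi : {linear B -> A},
    [/\ forall x y, phi (amul x y) = amul (phi x) (phi y),
        injective phi,
        range phi = S &
        forall n x, GB n x <-> GA n (phi x)].

Section Ideals.
Variables (K : fieldType) (A : nualgType K) (G : grading A).

Definition left_ideal (I : set A) : Prop :=
  [/\ I 0, (forall x y, I x -> I y -> I (x - y)) &
      (forall a x, I x -> I (amul a x))].

Definition two_sided_ideal (I : set A) : Prop :=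
  left_ideal I /\ (forall a x, I x -> I (amul x a)).

Definition ideal_generated (S : set A) : set A :=
  \bigcap_(I in [set I | two_sided_ideal I /\ S `<=` I]) I.

Definition sums_of (S : set A) : set A :=
  [set x | exists s : seq A, x = \sum_(y <- s) y /\ forall y, y \in s -> S y].

Definition graded_left_ideal (I : set A) : Prop :=
  left_ideal I /\ I `<=` sums_of [set y | I y /\ exists n, G n y].

Definition minimal_graded_left_ideal (I : set A) : Prop :=
  [/\ graded_left_ideal I, I <> [set 0] &
      forall J, graded_left_ideal J -> J `<=` I -> J = [set 0] \/ J = I].

Definition graded_socle : set A :=
  sums_of (\bigcup_(I in [set I | minimal_graded_left_ideal I]) I).

End Ideals.

Record digraph := Digraph {
  vertex : Type;
  edge : Type;
  source : edge -> vertex;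
  range_of : edge -> vertex }.

HB.instance Definition _ (E : digraph) := gen_eqMixin (vertex E).
HB.instance Definition _ (E : digraph) := gen_choiceMixin (vertex E).
HB.instance Definition _ (E : digraph) := gen_eqMixin (edge E).
HB.instance Definition _ (E : digraph) := gen_choiceMixin (edge E).

Section Graph.
Variable E : digraph.
Implicit Types (u v w : vertex E) (e f : edge E) (p c : seq (edge E)).

Fixpoint is_path v p w : bool :=
  if p is e :: p' then (source e == v) && is_path (range_of e) p' w else v == w.

(* A path of E, of length 0 or more, is recorded as its starting vertex together
   with its sequence of edges. *)
Definition gpath : Type := vertex E * seq (edge E).
HB.instance Definition _ := Choice.on gpath.

Definition path_end (q : gpath) : vertex E := last q.1 [seq range_of e | e <- q.2].
Definition ends_at (q : gpath) w : bool := is_path q.1 q.2 w.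
Definition path_vertices (q : gpath) : seq (vertex E) :=
  q.1 :: [seq range_of e | e <- q.2].

Definition tree v : set (vertex E) := [set w | exists p, is_path v p w].

Definition bifurcation v : Prop :=
  exists e f, [/\ e <> f, source e = v & source f = v].

Definition has_exit p : Prop :=
  exists e f, [/\ e \in p, source f = source e & f <> e].

Definition cycle_at w c : bool :=
  [&& c != [::], is_path w c w & uniq [seq source e | e <- c]].

Definition line_point v : Prop :=
  forall w, tree v w -> ~ bifurcation w /\ ~ exists c, cycle_at w c.

Definition laurent_vertex v : Prop :=
  exists mu w c,
    [/\ is_path v mu w,
        (forall u, u \in path_vertices (v, mu) -> ~ bifurcation u),
        cycle_at w c, ~ has_exit c &
        forall u, tree v u <-> u \in path_vertices (v, mu ++ c)].

Definition line_equiv u v : Prop := tree u `&` tree v !=set0.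

Definition line_representatives (X : set (vertex E)) : Prop :=
  X `<=` line_point /\
  forall u, line_point u -> exists! v, X v /\ line_equiv u v.

Definition cycle_without_exit c : Prop :=
  (exists w, cycle_at w c) /\ ~ has_exit c.

(* A cycle is recorded from its base on, so Y also chooses the base vertices. *)
Definition cycle_representatives (Y : set (seq (edge E))) : Prop :=
  Y `<=` cycle_without_exit /\
  forall c, cycle_without_exit c ->
    exists! c', Y c' /\ exists k, c' = rot k c.

(* If v is a sink, these are all the paths that end at v, with their lengths as
   degrees (line_pathsE, line_degE).  If v emits an edge, the paths that end at v
   are not enough: in v -> w, or on an infinite line starting at v, the vertex v is
   a line point at which one path ends, but the ideal of v is not a field.  The
   index set is therefore made of the paths p that stop where they first meet the
   line T(v); the matrix unit e_pq is p l_p^* l_q q^*, where l_p is the unique path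
   from v to the end of p, and p has degree |p| - |l_p|. *)
Definition line_paths v : set gpath :=
  [set q | exists w, [/\ tree v w, ends_at q w &
                         forall e, e \in q.2 -> ~ tree v (source e)]].

Definition dist v w : nat := size (xget [::] [set p | is_path v p w]).

Definition line_deg v (q : gpath) : int := (size q.2)%:Z - (dist v (path_end q))%:Z.

Definition cycle_paths c : set gpath :=
  [set q | exists w, [/\ cycle_at w c, ends_at q w &
                         ~ forall e, e \in c -> e \in q.2]].

Definition cycle_deg (q : gpath) : int := (size q.2)%:Z.

Lemma ends_at_end (q : gpath) w : ends_at q w -> path_end q = w.
Proof.
case: q => v p; rewrite /ends_at /path_end /=.
by elim: p v => [|e p IH] v /= => [/eqP|/andP[_ /IH]].
Qed.

Lemma tree_sink v : (forall e, source e <> v) -> tree v = [set v].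
Proof.
move=> vsink; apply/seteqP; split=> [w [[|e p] /=]|w ->].
- by move/eqP.
- by move=> /andP[/eqP /vsink].
- by exists [::] => /=.
Qed.

Lemma line_pathsE v : (forall e, source e <> v) ->
  line_paths v = [set q | ends_at q v].
Proof.
move=> vsink; rewrite /line_paths tree_sink//; apply/seteqP; split=> q /=.
  by move=> [w [-> ]].
by move=> qv; exists v; split=> // e _; exact: vsink.
Qed.

Lemma line_degE v (q : gpath) : (forall e, source e <> v) -> ends_at q v ->
  line_deg v q = (size q.2)%:Z.
Proof.
move=> vsink /ends_at_end qv; rewrite /line_deg qv (_ : dist v v = 0) ?subr0//.
rewrite /dist; case: xgetP => // -[|e p] _ //= /andP[/eqP svE].
by case: (vsink e).
Qed.

End Graph.

Section Leavitt.
Variables (K : fieldType) (E : digraph).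

Inductive generator :=
| GVertex of vertex E
| GEdge of edge E
| GGhost of edge E.

Inductive lterm :=
| LGen of generator
| LZero
| LOpp of lterm
| LAdd of lterm & lterm
| LScale of K & lterm
| LMul of lterm & lterm.

Local Notation "[ 'v' v ]" := (LGen (GVertex v)).
Local Notation "[ 'e' e ]" := (LGen (GEdge e)).
Local Notation "[ 'g' e ]" := (LGen (GGhost e)).
Local Notation "a ∘ b" := (LMul a b) (at level 40, left associativity).

Inductive lcong : lterm -> lterm -> Prop :=
| lcong_refl a : lcong a a
| lcong_sym a b : lcong a b -> lcong b a
| lcong_trans a b c : lcong a b -> lcong b c -> lcong a c
| lcong_opp a a' : lcong a a' -> lcong (LOpp a) (LOpp a')
| lcong_add a a' b b' : lcong a a' -> lcong b b' -> lcong (LAdd a b) (LAdd a' b')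
| lcong_scale k a a' : lcong a a' -> lcong (LScale k a) (LScale k a')
| lcong_mul a a' b b' : lcong a a' -> lcong b b' -> lcong (a ∘ b) (a' ∘ b')
| lcong_addA a b c : lcong (LAdd a (LAdd b c)) (LAdd (LAdd a b) c)
| lcong_addC a b : lcong (LAdd a b) (LAdd b a)
| lcong_add0 a : lcong (LAdd LZero a) a
| lcong_addN a : lcong (LAdd (LOpp a) a) LZero
| lcong_scaleA k l a : lcong (LScale k (LScale l a)) (LScale (k * l) a)
| lcong_scale1 a : lcong (LScale 1 a) a
| lcong_scaleDr k a b : lcong (LScale k (LAdd a b)) (LAdd (LScale k a) (LScale k b))
| lcong_scaleDl k l a : lcong (LScale (k + l) a) (LAdd (LScale k a) (LScale l a))
| lcong_mulA a b c : lcong (a ∘ (b ∘ c)) (a ∘ b ∘ c)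
| lcong_mulDl a b c : lcong (LAdd a b ∘ c) (LAdd (a ∘ c) (b ∘ c))
| lcong_mulDr a b c : lcong (a ∘ LAdd b c) (LAdd (a ∘ b) (a ∘ c))
| lcong_mulZl k a b : lcong (LScale k a ∘ b) (LScale k (a ∘ b))
| lcong_mulZr k a b : lcong (a ∘ LScale k b) (LScale k (a ∘ b))
| lcong_vv v : lcong ([v v] ∘ [v v]) [v v]
| lcong_vw v w : v <> w -> lcong ([v v] ∘ [v w]) LZero
| lcong_se e : lcong ([v source e] ∘ [e e]) [e e]
| lcong_er e : lcong ([e e] ∘ [v range_of e]) [e e]
| lcong_rg e : lcong ([v range_of e] ∘ [g e]) [g e]
| lcong_gs e : lcong ([g e] ∘ [v source e]) [g e]
| lcong_ge e : lcong ([g e] ∘ [e e]) [v range_of e]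
| lcong_gf e f : e <> f -> lcong ([g e] ∘ [e f]) LZero
| lcong_regular v (s : seq (edge E)) :
    s != [::] -> uniq s -> (forall e, e \in s <-> source e = v) ->
    lcong [v v] (foldr (fun e a => LAdd ([e e] ∘ [g e]) a) LZero s).

HB.instance Definition _ := gen_eqMixin lterm.
HB.instance Definition _ := gen_choiceMixin lterm.

Definition lcongb : rel lterm := fun a b => `[< lcong a b >].

Fact lcongb_refl : reflexive lcongb.
Proof. by move=> a; apply/asboolP; exact: lcong_refl. Qed.
Fact lcongb_sym : symmetric lcongb.
Proof. by move=> a b; apply/asboolP/asboolP; exact: lcong_sym. Qed.
Fact lcongb_trans : transitive lcongb.
Proof. by move=> b a c /asboolP ab /asboolP bc; apply/asboolP/(lcong_trans ab). Qed.

Canonical lcongb_equiv := EquivRel lcongb lcongb_refl lcongb_sym lcongb_trans.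

Definition leavitt := {eq_quot lcongb}.
HB.instance Definition _ := Choice.on leavitt.
HB.instance Definition _ := EqQuotient.on leavitt.

Definition lclass (a : lterm) : leavitt := \pi_leavitt a.

Lemma lclassP a b : lclass a = lclass b <-> lcong a b.
Proof. by split=> [/eqmodP/asboolP|ab]//; apply/eqmodP/asboolP. Qed.

Lemma lclass_repr (x : leavitt) : lclass (repr x) = x.
Proof. exact: reprK. Qed.

Lemma lcong_repr a : lcong (repr (lclass a)) a.
Proof. by apply/lclassP; rewrite lclass_repr. Qed.

Lemma leavitt_ind (P : leavitt -> Prop) :
  (forall a, P (lclass a)) -> forall x, P x.
Proof. by move=> Pa x; rewrite -(lclass_repr x). Qed.

Definition leavitt_opp (x : leavitt) := lclass (LOpp (repr x)).
Definition leavitt_add (x y : leavitt) := lclass (LAdd (repr x) (repr y)).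
Definition leavitt_scale k (x : leavitt) := lclass (LScale k (repr x)).
Definition leavitt_mul (x y : leavitt) := lclass (repr x ∘ repr y).

Let oppE a : leavitt_opp (lclass a) = lclass (LOpp a).
Proof. by apply/lclassP/lcong_opp/lcong_repr. Qed.
Let addE a b : leavitt_add (lclass a) (lclass b) = lclass (LAdd a b).
Proof. by apply/lclassP; apply: lcong_add; exact: lcong_repr. Qed.
Let scaleE k a : leavitt_scale k (lclass a) = lclass (LScale k a).
Proof. by apply/lclassP/lcong_scale/lcong_repr. Qed.
Let mulE a b : leavitt_mul (lclass a) (lclass b) = lclass (a ∘ b).
Proof. by apply/lclassP; apply: lcong_mul; exact: lcong_repr. Qed.

Let opE := (oppE, addE, scaleE, mulE).

Fact leavitt_addA : associative leavitt_add.
Proof.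
elim/leavitt_ind=> a; elim/leavitt_ind=> b; elim/leavitt_ind=> c.
by rewrite !opE; apply/lclassP; constructor.
Qed.
Fact leavitt_addC : commutative leavitt_add.
Proof.
elim/leavitt_ind=> a; elim/leavitt_ind=> b.
by rewrite !opE; apply/lclassP; constructor.
Qed.
Fact leavitt_add0 : left_id (lclass LZero) leavitt_add.
Proof. by elim/leavitt_ind=> a; rewrite !opE; apply/lclassP; constructor. Qed.
Fact leavitt_addN : left_inverse (lclass LZero) leavitt_opp leavitt_add.
Proof. by elim/leavitt_ind=> a; rewrite !opE; apply/lclassP; constructor. Qed.

HB.instance Definition _ := GRing.isZmodule.Build leavitt
  leavitt_addA leavitt_addC leavitt_add0 leavitt_addN.

Fact leavitt_scaleA k l x :
  leavitt_scale k (leavitt_scale l x) = leavitt_scale (k * l) x.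
Proof.
by elim/leavitt_ind: x => a; rewrite !opE; apply/lclassP; constructor.
Qed.
Fact leavitt_scale1 : left_id 1 leavitt_scale.
Proof. by elim/leavitt_ind=> a; rewrite !opE; apply/lclassP; constructor. Qed.
Fact leavitt_scaleDr : right_distributive leavitt_scale +%R.
Proof.
move=> k; elim/leavitt_ind=> a; elim/leavitt_ind=> b.
by rewrite /+%R /= !opE; apply/lclassP; constructor.
Qed.
Fact leavitt_scaleDl x : {morph leavitt_scale^~ x : k l / k + l}.
Proof.
elim/leavitt_ind: x => a k l.
by rewrite [RHS]/+%R /= !opE; apply/lclassP; constructor.
Qed.

HB.instance Definition _ := GRing.Zmodule_isLmodule.Build K leavitt
  leavitt_scaleA leavitt_scale1 leavitt_scaleDr leavitt_scaleDl.

Fact leavitt_mulA : associative leavitt_mul.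
Proof.
elim/leavitt_ind=> a; elim/leavitt_ind=> b; elim/leavitt_ind=> c.
by rewrite !opE; apply/lclassP; constructor.
Qed.
Fact leavitt_mulDl : left_distributive leavitt_mul +%R.
Proof.
elim/leavitt_ind=> a; elim/leavitt_ind=> b; elim/leavitt_ind=> c.
by rewrite /+%R /= !opE; apply/lclassP; constructor.
Qed.
Fact leavitt_mulDr : right_distributive leavitt_mul +%R.
Proof.
elim/leavitt_ind=> a; elim/leavitt_ind=> b; elim/leavitt_ind=> c.
by rewrite /+%R /= !opE; apply/lclassP; constructor.
Qed.
Fact leavitt_mulZl k (x y : leavitt) :
  leavitt_mul (k *: x) y = k *: leavitt_mul x y.
Proof.
elim/leavitt_ind: x => a; elim/leavitt_ind: y => b.
by rewrite /*:%R /= !opE; apply/lclassP; constructor.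
Qed.
Fact leavitt_mulZr k (x y : leavitt) :
  leavitt_mul x (k *: y) = k *: leavitt_mul x y.
Proof.
elim/leavitt_ind: x => a; elim/leavitt_ind: y => b.
by rewrite /*:%R /= !opE; apply/lclassP; constructor.
Qed.

HB.instance Definition _ := Lmodule_isNonUnitalAlgebra.Build K leavitt
  leavitt_mulA leavitt_mulDl leavitt_mulDr leavitt_mulZl leavitt_mulZr.

Definition lgen (g : generator) : leavitt := lclass (LGen g).

Definition lvertex v : leavitt := lgen (GVertex v).

Definition gen_degree (g : generator) : int :=
  match g with GVertex _ => 0 | GEdge _ => 1 | GGhost _ => -1 end.

(* L_n, the span of the products of generators of total degree n *)
Inductive leavitt_homog : int -> leavitt -> Prop :=
| homog_gen g : leavitt_homog (gen_degree g) (lgen g)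
| homog_mul m n x y : leavitt_homog m x -> leavitt_homog n y ->
    leavitt_homog (m + n) (amul x y)
| homog_zero n : leavitt_homog n 0
| homog_add n x y : leavitt_homog n x -> leavitt_homog n y ->
    leavitt_homog n (x + y)
| homog_scale n k x : leavitt_homog n x -> leavitt_homog n (k *: x).

End Leavitt.

Arguments lvertex K {E} v.
Arguments leavitt_homog K E n x : clear implicits.

Section SocleModel.
Variables (K : fieldType) (E : digraph).
Variables (X : set (vertex E)) (Y : set (seq (edge E))) (t : seq (edge E) -> nat).

Definition line_part :=
  dirsum (fun v : X => fmatrix (line_paths (val v)) K^o : nualgType K).

Definition line_part_homog : grading line_part :=
  dirsum_homog (fun v : X =>
    fmatrix_homog (@scalar_homog K) (fun q : line_paths (val v) => line_deg (val v) (val q))).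

Definition cycle_part :=
  dirsum (fun c : Y => fmatrix (cycle_paths (val c)) (laurent K (t (val c)))
                       : nualgType K).

Definition cycle_part_homog : grading cycle_part :=
  dirsum_homog (fun c : Y =>
    fmatrix_homog (@laurent_homog K (t (val c)))
      (fun q : cycle_paths (val c) => cycle_deg (val q))).

End SocleModel.

(* Main.v *)
Require Import Defs.
From HB Require Import structures.
From mathcomp Require Import all_boot all_order all_algebra finmap zify.
From mathcomp Require Import boolp classical_sets functions cardinality.

(** Call a vertex unbranched if it reaches no bifurcation.  A line point or a Laurent
    vertex is unbranched, and conversely an unbranched vertex is a line point or a
    Laurent vertex according to whether it reaches a cycle ([unbranchedE]).  Along a
    path [r] that starts at an unbranched vertex [w] every vertex passed emits exactly
    one edge, so [r r^* = w] ([path_ghost]): such paths are invertible.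

    The socle.  The reduction theorem ([homog_reduction]) provides, for every nonzero
    homogeneous [x], paths with [p^* x q = k w] for a vertex [w] and a scalar [k != 0].
    It gives both inclusions.  If [I] is a minimal graded left ideal and [x] lies in
    [I], then [y = p^* x] generates [I] and [w y = y], so [I] lies in the two-sided
    ideal of [w]; moreover two edges [e], [f] leaving the same vertex reached by [w]
    would make [e^*] generate a proper part of [I], so [w] is unbranched
    ([minimal_generator]).  Conversely, if [q] ends at an unbranched [w], then [L q^*]
    is a minimal graded left ideal, because a nonzero homogeneous element of it is sent
    back to [q^*] by reduction and the invertibility of paths starting at [w]
    ([principal_ghost_minimal]).  The sum of these ideals is also a right ideal, hence
    it is the ideal generated by the unbranched vertices ([graded_socleE]); it is
    spanned by the products [p q^*] of paths with the same unbranched end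
    ([socle_matrix_units]).

    The matrices.  A product [p^* q] vanishes unless one path extends the other
    ([ghost_path_neq0]).  The paths that stop where they first meet the line of a
    representative [v], and the paths to the base of a cycle [c] that do not run all
    through [c], are pairwise incomparable, which makes the elements
    [p l_p^* l_q q^*] and [p c^k q^*] multiply like matrix units, with coefficients in
    [K] and in the Laurent polynomials in [c] ([line_graded_system],
    [cycle_graded_system]).  Incomparability across different blocks holds because no
    path leads from one line or cycle to another.  A matrix entry is recovered by
    multiplying by the paths on both sides, so the resulting map is an isomorphism of
    graded algebras onto its image ([graded_iso_systems]) as soon as the vertices are
    nonzero and elements of different degrees are independent in [L].  These two facts
    need models of [L]: a branching system for the first ([lvertex_neq0]), the action
    of [L] on functions from the integers to [L] by shifts for the second
    ([homog_sum_eq]).  The image is the whole socle because an unbranched [w] has a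
    path [r] to a chosen line or cycle, and [p q^* = p r r^* q^*] ([socle_systems]). *)

Set Implicit Arguments.
Unset Strict Implicit.
Unset Printing Implicit Defensive.

Import Order.TTheory GRing.Theory Num.Theory.

Local Open Scope classical_set_scope.
Local Open Scope ring_scope.


(** * Paths and ghost paths in a Leavitt path algebra *)

Local Notation "x ⊙ y" := (amul x y) (at level 40, left associativity) : ring_scope.

Section PathElements.
Variables (K : fieldType) (E : digraph).
Local Notation L := (leavitt K E).
Implicit Types (u v w : vertex E) (e f : edge E) (p q r : seq (edge E)).

Definition ledge e : L := lgen K (GEdge e).
Definition lghost e : L := lgen K (GGhost e).

Lemma lclassM (a b : lterm K E) : lclass a ⊙ lclass b = lclass (LMul a b).
Proof. by apply/lclassP; apply: lcong_mul; exact: lcong_repr. Qed.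

Lemma lclassD (a b : lterm K E) : lclass a + lclass b = lclass (LAdd a b).
Proof. by apply/lclassP; apply: lcong_add; exact: lcong_repr. Qed.

Lemma lclassN (a : lterm K E) : - lclass a = lclass (LOpp a).
Proof. by apply/lclassP; apply: lcong_opp; exact: lcong_repr. Qed.

Lemma lclassZ k (a : lterm K E) : k *: lclass a = lclass (LScale k a).
Proof. by apply/lclassP; apply: lcong_scale; exact: lcong_repr. Qed.

Lemma vertex_idem v : lvertex K v ⊙ lvertex K v = lvertex K v.
Proof. by rewrite lclassM; apply/lclassP; constructor. Qed.

Lemma vertexM v w : lvertex K v ⊙ lvertex K w = if v == w then lvertex K v else 0.
Proof.
case: eqP => [<-|vw]; first exact: vertex_idem.
by rewrite lclassM; apply/lclassP; constructor.
Qed.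

Lemma source_ledge e : lvertex K (source e) ⊙ ledge e = ledge e.
Proof. by rewrite lclassM; apply/lclassP; constructor. Qed.
Lemma ledge_range e : ledge e ⊙ lvertex K (range_of e) = ledge e.
Proof. by rewrite lclassM; apply/lclassP; constructor. Qed.
Lemma range_lghost e : lvertex K (range_of e) ⊙ lghost e = lghost e.
Proof. by rewrite lclassM; apply/lclassP; constructor. Qed.
Lemma lghost_source e : lghost e ⊙ lvertex K (source e) = lghost e.
Proof. by rewrite lclassM; apply/lclassP; constructor. Qed.

Lemma vertex_ledge v e :
  lvertex K v ⊙ ledge e = if v == source e then ledge e else 0.
Proof.
by rewrite -source_ledge amulA vertexM; case: eqP => [->|] //; rewrite amul0x.
Qed.
Lemma lghost_vertex e v :
  lghost e ⊙ lvertex K v = if source e == v then lghost e else 0.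
Proof.
by rewrite -{1}lghost_source -amulA vertexM; case: eqP => [_|]; rewrite ?amulx0 ?lghost_source.
Qed.

Lemma lghost_ledge e f :
  lghost e ⊙ ledge f = if e == f then lvertex K (range_of e) else 0.
Proof. by rewrite lclassM; case: eqP => [<-|ef]; apply/lclassP; constructor. Qed.

Lemma vertex_regular v (s : seq (edge E)) :
  s != [::] -> uniq s -> (forall e, e \in s <-> source e = v) ->
  lvertex K v = \sum_(e <- s) ledge e ⊙ lghost e.
Proof.
move=> s0 us sv; rewrite (_ : lvertex K v = lclass (foldr
  (fun e a => LAdd (LMul (LGen K (GEdge e)) (LGen K (GGhost e))) a) (LZero K E) s)).
  elim: {s0 us sv} s => [|e s IH]; first by rewrite big_nil.
  by rewrite big_cons -IH /= lclassM lclassD.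
by apply/lclassP; constructor.
Qed.

(** The starting vertex is an argument because the empty sequence of edges does not
    determine it. *)
Fixpoint path_elt v p : L :=
  if p is e :: p' then ledge e ⊙ path_elt (range_of e) p' else lvertex K v.

Fixpoint ghost_elt v p : L :=
  if p is e :: p' then ghost_elt (range_of e) p' ⊙ lghost e else lvertex K v.

Lemma vertex_path u v p w : is_path v p w ->
  lvertex K u ⊙ path_elt v p = if u == v then path_elt v p else 0.
Proof.
case: p => [|e p] /=; first by move=> _; rewrite vertexM; case: eqP => [->|].
move=> /andP[/eqP <- _]; rewrite amulA vertex_ledge.
by case: eqP => // _; rewrite amul0x.
Qed.

Lemma path_vertex u v p w : is_path v p w ->
  path_elt v p ⊙ lvertex K u = if w == u then path_elt v p else 0.
Proof.
elim: p v => [|e p IH] v /=.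
  by move=> /eqP <-; rewrite vertexM.
move=> /andP[_ /IH]; rewrite -amulA => ->.
by case: eqP => // _; rewrite amulx0.
Qed.

Lemma ghost_vertex u v p w : is_path v p w ->
  ghost_elt v p ⊙ lvertex K u = if v == u then ghost_elt v p else 0.
Proof.
case: p => [|e p] /=; first by move=> _; rewrite vertexM.
move=> /andP[/eqP <- _]; rewrite -amulA lghost_vertex.
by case: eqP => // _; rewrite amulx0.
Qed.

Lemma vertex_ghost u v p w : is_path v p w ->
  lvertex K u ⊙ ghost_elt v p = if u == w then ghost_elt v p else 0.
Proof.
elim: p v => [|e p IH] v /=.
  by move=> /eqP <-; rewrite vertexM; case: eqP => [->|].
move=> /andP[_ /IH]; rewrite amulA => ->.
by case: eqP => // _; rewrite amul0x.
Qed.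

Lemma path_cat v p w q z : is_path v p w -> is_path w q z ->
  path_elt v (p ++ q) = path_elt v p ⊙ path_elt w q.
Proof.
move=> + qz; elim: p v => [|e p IH] v /=.
  by move=> /eqP ->; rewrite (vertex_path _ qz) eqxx.
by move=> /andP[_ /IH] ->; rewrite amulA.
Qed.

Lemma ghost_cat v p w q z : is_path v p w -> is_path w q z ->
  ghost_elt v (p ++ q) = ghost_elt w q ⊙ ghost_elt v p.
Proof.
move=> + qz; elim: p v => [|e p IH] v /=.
  by move=> /eqP ->; rewrite (ghost_vertex _ qz) eqxx.
by move=> /andP[_ /IH] ->; rewrite amulA.
Qed.

Lemma is_path_cat v p q w :
  is_path v (p ++ q) w <-> exists2 z, is_path v p z & is_path z q w.
Proof.
elim: p v => [|e p IH] v /=.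
  by split=> [qw|[z /eqP ->//]]; exists v.
split=> [/andP[-> /IH[z pz qw]]|[z /andP[-> pz] qw]]; first by exists z.
by apply/IH; exists z.
Qed.

Lemma path_end_uniq v p w w' : is_path v p w -> is_path v p w' -> w = w'.
Proof.
elim: p v => [|e p IH] v /=; first by move=> /eqP <- /eqP.
by move=> /andP[_ /IH wP] /andP[_ /wP].
Qed.

Lemma ghost_path v p w : is_path v p w -> ghost_elt v p ⊙ path_elt v p = lvertex K w.
Proof.
elim: p v => [|e p IH] v /=; first by move=> /eqP ->; rewrite vertex_idem.
move=> /andP[_ pw]; rewrite -amulA (amulA (lghost e)) lghost_ledge eqxx.
by rewrite (vertex_path _ pw) eqxx IH.
Qed.

(** A product [p^* q] collapses edge by edge as long as the two paths agree, and
    vanishes at the first edge where they differ. *)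
Lemma ghost_path_neq0 v p w v' q w' : is_path v p w -> is_path v' q w' ->
  ghost_elt v p ⊙ path_elt v' q <> 0 ->
  v = v' /\ ((exists r, q = p ++ r) \/ (exists r, p = q ++ r)).
Proof.
elim: p v q v' => [|e p IH] v q v' /=.
  move=> /eqP -> qw'; rewrite (vertex_path _ qw').
  by case: eqP => // -> _; split=> //; left; exists q.
case: q => [|f q] /=.
  move=> /andP[/eqP <- _] _; rewrite -amulA lghost_vertex; case: eqP => [<- _|_].
    by split=> //; right; exists (e :: p).
  by rewrite amulx0.
move=> /andP[/eqP <- pw] /andP[/eqP <- qw'].
rewrite -amulA (amulA (lghost e)) lghost_ledge; case: eqP => [ef|_]; last first.
  by rewrite amul0x amulx0.
subst f; rewrite (vertex_path _ qw'); case: eqP => [|_]; last by rewrite amulx0.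
move=> reE /(IH _ _ _ pw qw')[_ pq]; split=> //.
by case: pq => -[r ->]; [left|right]; exists r.
Qed.

(** A vertex that emits only [e] is regular, and its relation has a single term. *)
Lemma not_bifurcation_edge e : ~ bifurcation (source e) ->
  ledge e ⊙ lghost e = lvertex K (source e).
Proof.
move=> nb; rewrite (@vertex_regular _ [:: e])// ?big_seq1// => f.
rewrite inE; split=> [/eqP -> //|fe]; apply/eqP; apply: contrapT => ne.
by apply: nb; exists f, e.
Qed.

End PathElements.

Arguments ledge K {E} e.
Arguments lghost K {E} e.
Arguments path_elt K {E} v p.
Arguments ghost_elt K {E} v p.
Arguments vertex_path {K E} u {v p w}.
Arguments path_vertex {K E} u {v p w}.
Arguments ghost_vertex {K E} u {v p w}.
Arguments vertex_ghost {K E} u {v p w}.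
Arguments path_cat {K E v p w q z}.
Arguments ghost_cat {K E v p w q z}.
Arguments ghost_path {K E v p w}.
Arguments ghost_path_neq0 {K E v p w v' q w'}.

Section Unbranched.
Variable (E : digraph).
Implicit Types (u v w : vertex E) (e f : edge E) (p q r : seq (edge E)).

Definition unbranched v := forall w, tree v w -> ~ bifurcation w.

Lemma tree_refl v : tree v v. Proof. by exists [::] => /=. Qed.

Lemma tree_path v p w u : is_path v p w -> tree w u -> tree v u.
Proof. by move=> pw [q qu]; exists (p ++ q); apply/is_path_cat; exists w. Qed.

Lemma unbranched_path v p w : unbranched v -> is_path v p w -> unbranched w.
Proof. by move=> vu pw u wu; apply: vu; exact: tree_path pw wu. Qed.

(** The converse of [p^* p = w], which always holds: along such a path no edge can be
    missed, so nothing is lost by going forth and back. *)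
Lemma path_ghost K v p w : unbranched v -> is_path v p w ->
  path_elt K v p ⊙ ghost_elt K v p = lvertex K v.
Proof.
elim: p v => [|e p IH] v vu /=; first by rewrite vertex_idem.
move=> /andP[/eqP sev pw]; have ru : unbranched (range_of e).
  by apply: (@unbranched_path v [:: e]) => //=; rewrite sev !eqxx.
rewrite amulA -(amulA (ledge K e)) IH// ledge_range not_bifurcation_edge ?sev//.
by apply: vu; exact: tree_refl.
Qed.

End Unbranched.

(** * Representations, independence of degrees, and nonzero vertices *)

Section Representation.
Variables (K : fieldType) (E : digraph) (V : lmodType K).
Variable G : generator E -> V -> V.
Local Notation L := (leavitt K E).

(** The defining relations of the Leavitt path algebra for operators on a vector
    space: they are what an action of the algebra on [V] has to satisfy. *)
Record leavitt_family : Prop := LeavittFamily {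
  fam_linear : forall g k x y, G g (k *: x + y) = k *: G g x + G g y;
  fam_vv : forall v x, G (GVertex v) (G (GVertex v) x) = G (GVertex v) x;
  fam_vw : forall v w x, v <> w -> G (GVertex v) (G (GVertex w) x) = 0;
  fam_se : forall e x, G (GVertex (source e)) (G (GEdge e) x) = G (GEdge e) x;
  fam_er : forall e x, G (GEdge e) (G (GVertex (range_of e)) x) = G (GEdge e) x;
  fam_rg : forall e x, G (GVertex (range_of e)) (G (GGhost e) x) = G (GGhost e) x;
  fam_gs : forall e x, G (GGhost e) (G (GVertex (source e)) x) = G (GGhost e) x;
  fam_ge : forall e x, G (GGhost e) (G (GEdge e) x) = G (GVertex (range_of e)) x;
  fam_gf : forall e f x, e <> f -> G (GGhost e) (G (GEdge f) x) = 0;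
  fam_regular : forall v (s : seq (edge E)) x,
    s != [::] -> uniq s -> (forall e, e \in s <-> source e = v) ->
    G (GVertex v) x = \sum_(e <- s) G (GEdge e) (G (GGhost e) x) }.

Hypothesis famG : leavitt_family.

Fixpoint lterm_act (a : lterm K E) : V -> V :=
  match a with
  | LGen g => G g
  | LZero => fun=> 0
  | LOpp a => fun x => - lterm_act a x
  | LAdd a b => fun x => lterm_act a x + lterm_act b x
  | LScale k a => fun x => k *: lterm_act a x
  | LMul a b => fun x => lterm_act a (lterm_act b x)
  end.

Lemma lterm_act_linear a k x y :
  lterm_act a (k *: x + y) = k *: lterm_act a x + lterm_act a y.
Proof.
elim: a k x y => [g||a IHa|a IHa b IHb|l a IHa|a IHa b IHb] k x y /=.
- exact: (fam_linear famG).
- by rewrite scaler0 addr0.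
- by rewrite IHa opprD scalerN.
- by rewrite IHa IHb scalerDr addrACA.
- by rewrite IHa scalerDr !scalerA mulrC.
- by rewrite IHb IHa.
Qed.

Lemma lterm_actD a x y : lterm_act a (x + y) = lterm_act a x + lterm_act a y.
Proof. by have := lterm_act_linear a 1 x y; rewrite !scale1r. Qed.

Lemma lterm_act0 a : lterm_act a 0 = 0.
Proof. by have /eqP := lterm_actD a 0 0; rewrite addr0 -subr_eq subrr => /eqP. Qed.

Lemma lterm_actZ a k x : lterm_act a (k *: x) = k *: lterm_act a x.
Proof. by have := lterm_act_linear a k x 0; rewrite lterm_act0 !addr0. Qed.

Lemma lterm_act_cong a b : lcong a b -> lterm_act a =1 lterm_act b.
Proof.
elim=> {a b} /=.
- by [].
- by move=> a b _ IH x; rewrite IH.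
- by move=> a b c _ IH _ IH' x; rewrite IH IH'.
- by move=> a b _ IH x; rewrite IH.
- by move=> a a' b b' _ IH _ IH' x; rewrite IH IH'.
- by move=> k a b _ IH x; rewrite IH.
- by move=> a a' b b' _ IH _ IH' x; rewrite IH IH'.
- by move=> a b c x; rewrite addrA.
- by move=> a b x; rewrite addrC.
- by move=> a x; rewrite add0r.
- by move=> a x; rewrite addNr.
- by move=> k l a x; rewrite scalerA.
- by move=> a x; rewrite scale1r.
- by move=> k a b x; rewrite scalerDr.
- by move=> k l a x; rewrite scalerDl.
- by [].
- by [].
- by move=> a b c x; rewrite lterm_actD.
- by [].
- by move=> k a b x; rewrite lterm_actZ.
- by move=> v x; exact: (fam_vv famG).
- by move=> v w vw x; exact: (fam_vw famG).
- by move=> e x; exact: (fam_se famG).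
- by move=> e x; exact: (fam_er famG).
- by move=> e x; exact: (fam_rg famG).
- by move=> e x; exact: (fam_gs famG).
- by move=> e x; exact: (fam_ge famG).
- by move=> e f ef x; exact: (fam_gf famG).
- move=> v s s0 us sv x; rewrite (fam_regular famG _ s0 us sv).
  elim: {s0 us sv} s => [|e s IH] /=; first by rewrite big_nil.
  by rewrite big_cons IH.
Qed.

(** The choice of a representative is harmless by [lterm_act_cong]. *)
Definition leavitt_act (x : L) : V -> V := lterm_act (repr x).

Lemma leavitt_act_class a : leavitt_act (lclass a) =1 lterm_act a.
Proof. by apply: lterm_act_cong; exact: lcong_repr. Qed.

Lemma leavitt_act_gen g : leavitt_act (lgen K g) =1 G g.
Proof. exact: leavitt_act_class. Qed.

Lemma leavitt_act0 F : leavitt_act 0 F = 0.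
Proof. exact: (leavitt_act_class (LZero K E)). Qed.

Lemma leavitt_actD x y F : leavitt_act (x + y) F = leavitt_act x F + leavitt_act y F.
Proof.
elim/leavitt_ind: x => a; elim/leavitt_ind: y => b.
by rewrite lclassD !leavitt_act_class.
Qed.

Lemma leavitt_actZ k x F : leavitt_act (k *: x) F = k *: leavitt_act x F.
Proof. by elim/leavitt_ind: x => a; rewrite lclassZ !leavitt_act_class. Qed.

Lemma leavitt_actM x y F : leavitt_act (x ⊙ y) F = leavitt_act x (leavitt_act y F).
Proof.
elim/leavitt_ind: x => a; elim/leavitt_ind: y => b.
by rewrite lclassM !leavitt_act_class.
Qed.

Lemma leavitt_act_sum (J : Type) (r : seq J) (x : J -> L) F :
  leavitt_act (\sum_(j <- r) x j) F = \sum_(j <- r) leavitt_act (x j) F.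
Proof.
elim: r => [|j r IH]; first by rewrite !big_nil leavitt_act0.
by rewrite !big_cons leavitt_actD IH.
Qed.

End Representation.

Section Independence.
Variables (K : fieldType) (E : digraph).
Local Notation L := (leavitt K E).

(** Left multiplication together with a translation that records the degree.  All
    functions are allowed, not only those with finite support, so this is a substitute
    for the algebra of Laurent polynomials over [L]. *)
Definition shift_gen (g : generator E) (F : int -> L) : int -> L :=
  fun n => lgen K g ⊙ F (n - gen_degree g).

Lemma shift_gen_family : leavitt_family shift_gen.
Proof.
split; rewrite /shift_gen.
- move=> g k x y; apply: funext => n.
  by rewrite !fctE amulDr amulZr.
- by move=> v F; apply: funext => n /=; rewrite !subr0 amulA vertex_idem.
- move=> v w F /eqP /negPf vw; apply: funext => n /=.
  by rewrite amulA vertexM vw amul0x.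
- by move=> e F; apply: funext => n /=; rewrite subr0 amulA source_ledge.
- by move=> e F; apply: funext => n /=; rewrite subr0 amulA ledge_range.
- by move=> e F; apply: funext => n /=; rewrite subr0 amulA range_lghost.
- by move=> e F; apply: funext => n /=; rewrite subr0 amulA lghost_source.
- move=> e F; apply: funext => n /=.
  by rewrite amulA lghost_ledge eqxx opprK addrK subr0.
- move=> e f F /eqP /negPf ef; apply: funext => n /=.
  by rewrite amulA lghost_ledge ef amul0x.
- move=> v s F s0 us sv; apply: funext => n /=; rewrite fct_sumE subr0.
  rewrite -/(lvertex K v) (vertex_regular K s0 us sv) amul_suml; apply: eq_bigr => e _.
  by rewrite amulA opprK subrK.
Qed.

Lemma shift_act_homog m x : leavitt_homog K E m x ->
  forall F n, leavitt_act shift_gen x F n = x ⊙ F (n - m).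
Proof.
have fam := shift_gen_family; elim=> {m x}.
- by move=> g F n; rewrite leavitt_act_gen.
- move=> m m' x y _ IHx _ IHy F n.
  by rewrite leavitt_actM// IHx IHy amulA opprD addrA.
- by move=> m F n; rewrite leavitt_act0// amul0x.
- by move=> m x y _ IHx _ IHy F n; rewrite leavitt_actD// fctE IHx IHy amulDl.
- by move=> m k x _ IHx F n; rewrite leavitt_actZ// fctE IHx amulZl.
Qed.

(** The shifted action moves the value at 0 of a function to the place given by the
    degree, so the terms of a sum can be read off separately. *)
Lemma homog_sum_eq (J : eqType) (r : seq J) (x : J -> L) (d : J -> int) m y :
    uniq r -> {in r &, injective d} ->
    (forall j, j \in r -> leavitt_homog K E (d j) (x j)) ->
    leavitt_homog K E m y -> \sum_(j <- r) x j = y ->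
  forall j, j \in r -> d j != m -> forall u, x j ⊙ u = 0.
Proof.
move=> ur dinj xr my xy j jr djm u; have fam := shift_gen_family.
(* A function supported at 0: the component of degree [i] moves its value to [i]. *)
pose F : int -> L := fun n => if n == 0 then u else 0.
have Fhom i z n : leavitt_homog K E i z ->
    leavitt_act shift_gen z F n = if n == i then z ⊙ u else 0.
  move=> iz; rewrite (shift_act_homog iz) /F subr_eq0.
  by case: eqP => // _; rewrite amulx0.
have := congr1 (fun z => leavitt_act shift_gen z F (d j)) xy.
rewrite leavitt_act_sum// fct_sumE (Fhom m _ _ my) (negPf djm) (bigD1_seq j)//=.
rewrite (Fhom _ _ _ (xr _ jr)) eqxx big_seq_cond big1 ?addr0// => i /andP[ir ij].
rewrite (Fhom _ _ _ (xr _ ir)); case: eqP => // dij.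
by case/eqP: ij; apply: dinj.
Qed.

End Independence.

Section Nonzero.
Variables (K : fieldType) (E : digraph).
Local Notation L := (leavitt K E).
Implicit Types (v w : vertex E) (e : edge E).

Definition regular v (s : seq (edge E)) : Prop :=
  [/\ s != [::], uniq s & forall e, e \in s <-> source e = v].

(** It is empty exactly at the vertices that are not regular, so that it also decides
    regularity. *)
Definition out_edges v : seq (edge E) := xget [::] [set s | regular v s].

Lemma out_edges_regular v : out_edges v != [::] -> regular v (out_edges v).
Proof. by rewrite /out_edges; case: xgetP. Qed.

Lemma regular_out_edges v s : regular v s -> out_edges v != [::].
Proof.
rewrite /out_edges => rs; case: xgetP => [s' _ []//|/(_ s)]; by [].
Qed.

(** The points of a branching system: every vertex owns a copy of the same set of
    codes, whose second component is an integer to be divided by the number of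
    edges at the regular vertices, and whose first component is a stack of edges to
    be popped at the other vertices. *)
Definition point : Type := vertex E * (seq (edge E) * nat).

Definition point_cons e (x : point) : point :=
  let s := out_edges (source e) in
  (source e, if s is [::] then (e :: x.2.1, x.2.2)
             else (x.2.1, x.2.2 * size s + index e s)%N).

Definition point_uncons e (x : point) : option point :=
  let s := out_edges x.1 in
  if s is [::] then
    if x.2.1 is f :: l then
      if (f == e) && (source e == x.1) then Some (range_of e, (l, x.2.2)) else None
    else None
  else if (source e == x.1) && (x.2.2 %% size s == index e s)%N
       then Some (range_of e, (x.2.1, x.2.2 %/ size s)%N) else None.

Lemma point_consK e x : x.1 = range_of e -> point_uncons e (point_cons e x) = Some x.
Proof.
case: x => v [l n] /= ->; rewrite /point_uncons /point_cons /=.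
have := @out_edges_regular (source e).
case: (out_edges (source e)) => [|f s] /=; first by rewrite !eqxx.
case=> // _ us fs; have sz : (0 < size (f :: s))%N by [].
have es : e \in f :: s by exact/fs.
have lt : (index e (f :: s) < size (f :: s))%N by rewrite index_mem.
by rewrite eqxx -/(size (f :: s)) modnMDl modn_small// eqxx divnMDl// divn_small// addn0.
Qed.

Lemma point_cons_neq e f x : e <> f -> point_uncons e (point_cons f x) = None.
Proof.
move=> ef; rewrite /point_uncons /point_cons /=.
have := @out_edges_regular (source f).
case: (out_edges (source f)) => [|g s] /=; first by case: eqP => // fe; case: ef.
case=> // _ us fs; have sz : (0 < size (g :: s))%N by [].
case: eqP => //= sef.
have lt : (index f (g :: s) < size (g :: s))%N by rewrite index_mem; exact/fs.
rewrite -/(size (g :: s)) modnMDl modn_small//.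
have es : e \in g :: s by exact/fs.
have fs' : f \in g :: s by exact/fs.
case: eqP => // ife; have {}ife : index f (g :: s) = index e (g :: s) := ife.
by case: ef; rewrite -(nth_index e es) -ife nth_index.
Qed.

Lemma point_unconsK e x y : point_uncons e x = Some y ->
  [/\ x = point_cons e y, y.1 = range_of e & x.1 = source e].
Proof.
case: x => v [l n]; rewrite /point_uncons /point_cons /=.
case os : (out_edges v) => [|g s].
  case: l => // f l; case: andP => // -[/eqP -> /eqP sv] [<-] /=.
  by rewrite sv os.
case: andP => // -[/eqP sv /eqP nE] [<-] /=; rewrite sv os; split=> //.
by rewrite -nE -divn_eq.
Qed.


(** Together with [point_cons_neq]: exactly one edge can be removed from a point above
    a regular vertex, which is the relation [v = \sum_e e e^*]. *)
Lemma point_uncons_regular v s x : regular v s -> x.1 = v ->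
  exists2 e, e \in s & exists y, point_uncons e x = Some y.
Proof.
case: x => u [l n] /= rs ->.
have os := regular_out_edges rs; have [_ us ov] := out_edges_regular os.
have [_ _ sv] := rs; move: os us ov; rewrite /point_uncons /=.
case: (out_edges v) => // g t _ ut ov.
have lt : (n %% size (g :: t) < size (g :: t))%N by rewrite ltn_mod.
have nv := mem_nth g lt; have nsv := (ov _).1 nv.
exists (nth g (g :: t) (n %% size (g :: t))); first exact/sv.
by rewrite nsv eqxx index_uniq// eqxx; eexists.
Qed.

(** Edges act on functions on the points by substitution of [point_uncons], ghost
    edges by substitution of [point_cons]. *)
Definition point_gen (g : generator E) (F : point -> K^o) : point -> K^o :=
  match g with
  | GVertex v => fun x => if x.1 == v then F x else 0
  | GEdge e => fun x => if point_uncons e x is Some y then F y else 0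
  | GGhost e => fun x => if x.1 == range_of e then F (point_cons e x) else 0
  end.

Lemma point_gen_family : leavitt_family point_gen.
Proof.
split.
- case=> [v|e|e] k F H; apply: funext => x; rewrite !fctE /=.
  + by case: eqP => // _; rewrite scaler0 addr0.
  + by case: (point_uncons e x) => //; rewrite scaler0 addr0.
  + by case: eqP => // _; rewrite scaler0 addr0.
- by move=> v F; apply: funext => x /=; case: eqP.
- move=> v w F vw; apply: funext => x /=; case: eqP => // ->.
  by case: eqP.
- move=> e F; apply: funext => x /=; case E1: (point_uncons e x) => [y|].
    by have [_ _ ->] := point_unconsK E1; rewrite eqxx.
  by case: eqP.
- move=> e F; apply: funext => x /=; case E1: (point_uncons e x) => [y|//].
  by have [_ -> _] := point_unconsK E1; rewrite eqxx.
- by move=> e F; apply: funext => x /=; case: eqP.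
- by move=> e F; apply: funext => x /=; rewrite eqxx.
- move=> e F; apply: funext => x /=; case: eqP => // xe.
  by rewrite point_consK.
- move=> e f F ef; apply: funext => x /=; case: eqP => // xe.
  by rewrite point_cons_neq// => fe; apply: ef.
- move=> v s F s0 us sv; apply: funext => x /=; rewrite fct_sumE /=.
  case: eqP => [xv|xv]; last first.
    rewrite big_seq big1// => e /sv es; case E1: (point_uncons e x) => [y|//].
    by have [_ _ xs] := point_unconsK E1; case: xv; rewrite xs.
  have rs : regular v s by split.
  have [e es [y E1]] := point_uncons_regular rs xv; have [xE yE _] := point_unconsK E1.
  rewrite (bigD1_seq e)//= E1 yE eqxx -xE big1 ?addr0// => f fe.
  rewrite {1}xE point_cons_neq//; exact/eqP.
Qed.

(** The constant function 1 is not annihilated by [v], because every vertex owns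
    points. *)
Lemma lvertex_neq0 v : lvertex K v != 0.
Proof.
apply/eqP => v0; have fam := point_gen_family.
have := leavitt_act0 fam (fun=> 1); rewrite -v0 leavitt_act_gen//.
move=> /(congr1 (@^~ (v, ([::], 0%N)))).
by rewrite /= eqxx => /eqP; rewrite oner_eq0.
Qed.

End Nonzero.

(** * Spans of monomials and graded reduction *)

Section AlgebraLemmas.
Variables (K : fieldType) (A : nualgType K).
Implicit Types x y z : A.

Lemma amulxN x y : x ⊙ (- y) = - (x ⊙ y).
Proof. by rewrite -[- y]scaleN1r amulZr scaleN1r. Qed.
Lemma amulNx x y : (- x) ⊙ y = - (x ⊙ y).
Proof. by rewrite -[- x]scaleN1r amulZl scaleN1r. Qed.
Lemma amulBr x y z : x ⊙ (y - z) = x ⊙ y - x ⊙ z.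
Proof. by rewrite amulDr amulxN. Qed.
Lemma amulBl x y z : (x - y) ⊙ z = x ⊙ z - y ⊙ z.
Proof. by rewrite amulDl amulNx. Qed.

(** A span presented by lists of terms, so that statements about it are proved by
    induction on the number of terms. *)
Inductive lspan (P : set A) : A -> Prop :=
| lspan0 : lspan P 0
| lspanS k a x : P a -> lspan P x -> lspan P (k *: a + x).

Implicit Types P Q : set A.

Lemma lspanD P x y : lspan P x -> lspan P y -> lspan P (x + y).
Proof.
by move=> + Py; elim=> [|k a {}x Pa _ IH]; rewrite ?add0r// -addrA; constructor.
Qed.

Lemma lspanZ P k x : lspan P x -> lspan P (k *: x).
Proof.
elim=> [|l a {}x Pa _ IH]; first by rewrite scaler0; constructor.
by rewrite scalerDr scalerA; constructor.
Qed.

Lemma lspan_gen P x : P x -> lspan P x.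
Proof. by move=> Px; rewrite -[x]addr0 -[x]scale1r; constructor=> //; constructor. Qed.

Lemma lspan_sum (J : eqType) (r : seq J) (F : J -> A) P :
  (forall j, j \in r -> lspan P (F j)) -> lspan P (\sum_(j <- r) F j).
Proof.
move=> rP; rewrite big_seq; elim/big_ind: _ => //; first exact: lspan0.
by move=> x y; exact: lspanD.
Qed.

Lemma lspan_mulr P Q y : (forall a, P a -> lspan Q (a ⊙ y)) ->
  forall x, lspan P x -> lspan Q (x ⊙ y).
Proof.
move=> PQ x; elim=> [|k a {}x Pa _ IH]; first by rewrite amul0x; constructor.
by rewrite amulDl amulZl; apply: lspanD => //; apply/lspanZ/PQ.
Qed.

Lemma lspan_mull P Q y : (forall a, P a -> lspan Q (y ⊙ a)) ->
  forall x, lspan P x -> lspan Q (y ⊙ x).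
Proof.
move=> PQ x; elim=> [|k a {}x Pa _ IH]; first by rewrite amulx0; constructor.
by rewrite amulDr amulZr; apply: lspanD => //; apply/lspanZ/PQ.
Qed.

Lemma lspan_sub P Q : (forall a, P a -> lspan Q a) ->
  forall x, lspan P x -> lspan Q x.
Proof.
move=> PQ x; elim=> [|k a {}x Pa _ IH]; first by constructor.
by apply: lspanD => //; apply/lspanZ/PQ.
Qed.

End AlgebraLemmas.

Section Monomials.
Variables (K : fieldType) (E : digraph).
Local Notation L := (leavitt K E).
Implicit Types (u v w : vertex E) (e f : edge E).

(** The products [p q^*] of degree [d]; the bound on the ghost part is the quantity on
    which the reduction theorem is proved by induction. *)
Definition monomial (d : int) (N : nat) : set L :=
  [set x | exists v p u q w, [/\ is_path v p w, is_path u q w,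
    (size p)%:Z - (size q)%:Z = d, (size q <= N)%N & x = path_elt K v p ⊙ ghost_elt K u q]].

Lemma monomial_leq d N N' x : (N <= N')%N -> lspan (monomial d N) x ->
  lspan (monomial d N') x.
Proof.
move=> NN'; apply: lspan_sub => a [v [p [u [q [w [pw qw pq qN ->]]]]]].
by apply: lspan_gen; exists v, p, u, q, w; split=> //; exact: leq_trans NN'.
Qed.

Lemma gen_monomial (g : generator E) d N x : monomial d N x ->
  lspan (monomial (gen_degree g + d) N.+1) (lgen K g ⊙ x).
Proof.
move=> [v [p [u [q [w [pw qw pq qN ->]]]]]].
case: g => [z|e|e] /=; rewrite amulA.
- rewrite -/(lvertex K z) (vertex_path _ pw) add0r; case: eqP => [_|_]; last first.
    by rewrite amul0x; exact: lspan0.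
  by apply: lspan_gen; exists v, p, u, q, w; split=> //; exact: leqW.
- rewrite -/(ledge K e) -(ledge_range K e) -(amulA (ledge K e)) (vertex_path _ pw).
  case: eqP => [rev|_]; last by rewrite amulx0 amul0x; exact: lspan0.
  apply: lspan_gen; exists (source e), (e :: p), u, q, w; split=> //=.
  + by rewrite eqxx rev.
  + by rewrite -pq addrA -PoszD add1n.
  + exact: leqW.
  + by rewrite rev.
- rewrite -/(lghost K e); case: p pw pq => [|f p] /= pw pq.
    rewrite lghost_vertex; case: eqP => [sev|_]; last first.
      by rewrite amul0x; exact: lspan0.
    move: pw => /eqP vw; apply: lspan_gen.
    exists (range_of e), [::], u, (rcons q e), (range_of e); split=> //=.
    + by rewrite -cats1; apply/is_path_cat; exists w => //=; rewrite sev vw !eqxx.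
    + by rewrite size_rcons -pq !sub0r -addn1 PoszD opprD addrC.
    + by rewrite size_rcons.
    + rewrite -cats1 (ghost_cat (z := range_of e) qw) /=; last first.
        by rewrite sev vw !eqxx.
      by rewrite range_lghost amulA range_lghost.
  move: pw => /andP[_ pw]; rewrite amulA lghost_ledge.
  case: eqP => [ef|_]; last by rewrite !amul0x; exact: lspan0.
  subst f; rewrite (vertex_path _ pw) eqxx; apply: lspan_gen.
  exists (range_of e), p, u, q, w; split=> //; last exact: leqW.
  by rewrite -pq; lia.
Qed.

Lemma homog_monomial m x : leavitt_homog K E m x ->
  forall d N y, lspan (monomial d N) y ->
  exists N', lspan (monomial (m + d) N') (x ⊙ y).
Proof.
elim=> {m x}.
- move=> g d N y yP; exists N.+1; apply: lspan_mull yP => a; exact: gen_monomial.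
- move=> m n x y _ IHx _ IHy d N z /IHy[N' /IHx[N'' zP]].
  by exists N''; rewrite -amulA -addrA.
- by move=> n d N y _; exists 0; rewrite amul0x; exact: lspan0.
- move=> n x y _ IHx _ IHy d N z zP.
  have [Nx xP] := IHx _ _ _ zP; have [Ny yP] := IHy _ _ _ zP.
  exists (maxn Nx Ny); rewrite amulDl; apply: lspanD.
    by apply: monomial_leq xP; rewrite leq_maxl.
  by apply: monomial_leq yP; rewrite leq_maxr.
- move=> n k x _ IHx d N z zP; have [Nx xP] := IHx _ _ _ zP.
  by exists Nx; rewrite amulZl; exact: lspanZ.
Qed.

(** A product of generators is rewritten into monomials from the right: left
    multiplication by one generator turns a monomial into a monomial or into 0. *)
Lemma homog_span d x : leavitt_homog K E d x -> exists N, lspan (monomial d N) x.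
Proof.
elim=> {d x}.
- case=> [v|e|e].
  + exists 0; apply: lspan_gen; exists v, [::], v, [::], v.
    by split; rewrite /= ?eqxx// vertex_idem.
  + exists 0; apply: lspan_gen.
    exists (source e), [:: e], (range_of e), [::], (range_of e).
    by split; rewrite /= ?eqxx// !ledge_range.
  + exists 1; apply: lspan_gen.
    exists (range_of e), [::], (source e), [:: e], (range_of e).
    by split; rewrite /= ?eqxx// amulA vertex_idem range_lghost.
- by move=> m n x y xm _ _ [N yP]; exact: homog_monomial xm _ _ _ yP.
- by exists 0; exact: lspan0.
- move=> n x y _ [N xP] _ [M yP]; exists (maxn N M); apply: lspanD.
    by apply: monomial_leq xP; rewrite leq_maxl.
  by apply: monomial_leq yP; rewrite leq_maxr.
- by move=> n k x _ [N xP]; exists N; exact: lspanZ.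
Qed.

Lemma homog_path v p w : is_path v p w -> leavitt_homog K E (size p) (path_elt K v p).
Proof.
elim: p v => [|e p IH] v /=; first by move=> _; exact: (homog_gen K (GVertex v)).
move=> /andP[_ /IH pP]; rewrite -add1n PoszD.
exact: homog_mul (homog_gen K (GEdge e)) pP.
Qed.

Lemma homog_ghost v p w : is_path v p w -> leavitt_homog K E (- (size p)%:Z) (ghost_elt K v p).
Proof.
elim: p v => [|e p IH] v /=; first by move=> _; exact: (homog_gen K (GVertex v)).
move=> /andP[_ /IH pP]; rewrite -addn1 PoszD opprD.
exact: homog_mul pP (homog_gen K (GGhost e)).
Qed.

Lemma vertex_unit (s : seq (vertex E)) v : uniq s -> v \in s ->
  lvertex K v ⊙ \sum_(u <- s) lvertex K u = lvertex K v.
Proof.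
move=> us vs; rewrite amul_sumr (bigD1_seq v)//= vertex_idem big1 ?addr0// => u.
by rewrite vertexM eq_sym => /negPf ->.
Qed.

(** The algebra has no unit, but the sum of the vertices at which the ghost parts of
    the terms of [x] start is a right unit for [x]. *)
Lemma homog_unit d x : leavitt_homog K E d x ->
  exists s : seq (vertex E), x ⊙ \sum_(u <- s) lvertex K u = x.
Proof.
move=> /homog_span[N xP].
suff [s0 s0P] : exists s0 : seq (vertex E), forall s, uniq s -> {subset s0 <= s} ->
    x ⊙ \sum_(u <- s) lvertex K u = x.
  by exists (undup s0); apply: s0P; rewrite ?undup_uniq// => u; rewrite mem_undup.
elim: xP => [|k a {}x [v [p [u [q [w [pw qw _ _ ->]]]]]] _ [s0 IH]].
  by exists [::] => s _ _; rewrite amul0x.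
exists (u :: s0) => s us s0s; rewrite amulDl IH//; last first.
  by move=> z zs; apply: s0s; rewrite inE zs orbT.
have uE : ghost_elt K u q = ghost_elt K u q ⊙ lvertex K u by rewrite (ghost_vertex _ qw) eqxx.
by rewrite amulZl -amulA uE -(amulA _ (lvertex K u)) vertex_unit ?s0s// ?inE ?eqxx.
Qed.

Lemma homog_vertex_neq0 d x : leavitt_homog K E d x -> x <> 0 ->
  exists v, x ⊙ lvertex K v <> 0.
Proof.
move=> /homog_unit[s xs] x0; apply: contrapT => nv; apply: x0.
rewrite -xs amul_sumr big1// => v _; apply: contrapT => xv; apply: nv.
by exists v.
Qed.

Lemma lspan_monomial_homog d N x : lspan (monomial d N) x -> leavitt_homog K E d x.
Proof.
elim=> [|k a {}x [v [p [u [q [w [pw qw <- _ ->]]]]]] _ IH]; first exact: homog_zero.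
apply: homog_add => //; apply: homog_scale.
by apply: homog_mul; [exact: homog_path pw | exact: homog_ghost qw].
Qed.

Definition real_path v (d : int) (q : gpath E) : Prop :=
  ends_at q v /\ (size q.2)%:Z = d.

Definition real_elements v d : set L :=
  [set x | exists2 q : gpath E, real_path v d q & x = path_elt K q.1 q.2].

(** Two paths of the same length can only be comparable if they are equal. *)
Lemma real_orthogonal v d (p q : gpath E) : real_path v d p -> real_path v d q ->
  ghost_elt K p.1 p.2 ⊙ path_elt K q.1 q.2 = if p == q then lvertex K v else 0.
Proof.
move=> [pv pd] [qv qd]; case: eqP => [<-|pq]; first exact: ghost_path.
apply: contrapT => /(ghost_path_neq0 pv qv)[pq1 pq2]; apply: pq.
have [spq] : (size p.2)%:Z = size q.2 by rewrite pd qd.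
case: p q pq1 pq2 spq {pv pd qv qd} => [u p] [u' q] /= <- [][r ->].
  rewrite size_cat => /eqP; rewrite -[X in X == _]addn0 eqn_add2l eq_sym.
  by move=> /nilP ->; rewrite cats0.
rewrite size_cat => /eqP; rewrite -[X in _ == X]addn0 eqn_add2l.
by move=> /nilP ->; rewrite cats0.
Qed.

(** For finitely many paths of the same length [\sum_q q q^*] fixes every combination
    [x] of them, so some [q^* x] is nonzero; and [q^* x] is the coefficient of [q]. *)
Lemma real_leading v d x : lspan (real_elements v d) x -> x <> 0 ->
  exists (q : gpath E) k,
    [/\ real_path v d q, k != 0 & ghost_elt K q.1 q.2 ⊙ x = k *: lvertex K v].
Proof.
move=> xP x0.
have coef (q : gpath E) : real_path v d q ->
    exists k, ghost_elt K q.1 q.2 ⊙ x = k *: lvertex K v.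
  move=> qP; elim: xP => [|k a y [p pP ->] _ [l IH]].
    by exists 0; rewrite amulx0 scale0r.
  rewrite amulDr amulZr IH (real_orthogonal qP pP).
  by case: eqP => _; [exists (k + l); rewrite scalerDl | exists l; rewrite scaler0 add0r].
have [s0 [s0v s0P]] : exists s0 : seq (gpath E), (forall q, q \in s0 -> real_path v d q) /\
    forall s, uniq s -> (forall q, q \in s -> real_path v d q) -> {subset s0 <= s} ->
    \sum_(q <- s) path_elt K q.1 q.2 ⊙ ghost_elt K q.1 q.2 ⊙ x = x.
  elim: xP => [|k a y [p pP ->] _ [s0 [s0v IH]]].
    by exists [::]; split=> // s _ _ _; rewrite big1// => q _; rewrite amulx0.
  exists (p :: s0); split=> [q|s us sv s0s].
    by rewrite inE => /orP[/eqP -> //|]; exact: s0v.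
  under eq_bigr do rewrite amulDr amulZr; rewrite big_split /= IH//; last first.
    by move=> q qs; apply: s0s; rewrite inE qs orbT.
  rewrite -scaler_sumr; congr (_ *: _ + _).
  have ps : p \in s by apply: s0s; rewrite inE eqxx.
  rewrite (bigD1_seq p)//= -amulA (ghost_path pP.1).
  rewrite (path_vertex _ pP.1) eqxx big_seq_cond big1 ?addr0// => q /andP[qs qp].
  by rewrite -amulA (real_orthogonal (sv _ qs) pP) (negPf qp) amulx0.
apply: contrapT => nq; apply: x0.
rewrite -(s0P (undup s0)) ?undup_uniq//; last first.
- by move=> q; rewrite mem_undup.
- by move=> q; rewrite mem_undup; exact: s0v.
rewrite big_seq big1// => q; rewrite mem_undup => /s0v qP.
have [k kE] := coef _ qP; rewrite -amulA kE.
have [->|k0] := eqVneq k 0; first by rewrite scale0r amulx0.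
by case: nq; exists q, k.
Qed.

(** What remains of [v] when the edges of [S] are removed; it is 0 when [S]
    enumerates the edges leaving a regular vertex [v]. *)
Definition cut v (S : seq (edge E)) : L :=
  lvertex K v - \sum_(e <- S) ledge K e ⊙ lghost K e.

Lemma cut_ledge v S e : source e = v -> e \notin S -> cut v S ⊙ ledge K e = ledge K e.
Proof.
move=> sev eS; rewrite amulBl -{1}sev source_ledge amul_suml big_seq big1 ?subr0//.
move=> f fS; rewrite -amulA lghost_ledge; case: eqP => [fe|_]; last by rewrite amulx0.
by rewrite -fe fS in eS.
Qed.

Lemma lghost_cut v S e : source e = v -> uniq S -> e \in S -> lghost K e ⊙ cut v S = 0.
Proof.
move=> sev uS eS; rewrite amulBr -{1}sev lghost_source amul_sumr (bigD1_seq e)//=.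
rewrite amulA lghost_ledge eqxx range_lghost big1 ?addr0 ?subrr// => f fe.
by rewrite amulA lghost_ledge eq_sym (negPf fe) amul0x.
Qed.

Lemma vertex_cut u v S : (forall e, e \in S -> source e = v) ->
  lvertex K u ⊙ cut v S = if u == v then cut v S else 0.
Proof.
move=> Sv; rewrite amulBr vertexM amul_sumr.
rewrite (_ : \sum_(_ <- _) _ = if u == v then \sum_(e <- S) ledge K e ⊙ lghost K e else 0).
  by case: eqP => [->//|_]; rewrite subrr.
case: eqP => [->|uv].
  by rewrite !big_seq; apply: eq_bigr => e /Sv <-; rewrite amulA source_ledge.
rewrite big_seq big1// => e /Sv sev; rewrite amulA vertex_ledge.
by case: eqP => [ue|_]; rewrite ?amul0x//; case: uv; rewrite ue.
Qed.

(** Multiplying by [v - \sum_(e <- S) e e^*], for a large enough finite set [S] of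
    edges leaving [v], kills the monomials whose ghost part is nontrivial. *)
Lemma monomial_cut v d N x : lspan (monomial d N) x ->
  exists S0 : seq (edge E), (forall e, e \in S0 -> source e = v) /\
  forall S, uniq S -> (forall e, e \in S -> source e = v) -> {subset S0 <= S} ->
  exists2 y, lspan (real_elements v d) y & x ⊙ cut v S = y ⊙ cut v S.
Proof.
elim=> [|k a {}x [u [p [z [q [w [pw qw pq _ ->]]]]]] _ [S0 [S0v IH]]].
  by exists [::]; split=> // S _ _ _; exists 0; rewrite ?amul0x//; exact: lspan0.
have [zv|zv] := eqVneq z v; last first.
  exists S0; split=> // S uS Sv S0S; have [y yP xy] := IH _ uS Sv S0S.
  exists y => //; rewrite amulDl xy amulZl -amulA.
  have -> : ghost_elt K z q = ghost_elt K z q ⊙ lvertex K z by rewrite (ghost_vertex _ qw) eqxx.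
  by rewrite -(amulA (ghost_elt _ _ _)) vertex_cut// (negPf zv) !amulx0 scaler0 add0r.
subst z; case: q qw pq => [|e q] /= qw pq.
  move/eqP: qw => qw; subst w; rewrite subr0 in pq.
  exists S0; split=> // S uS Sv S0S; have [y yP xy] := IH _ uS Sv S0S.
  exists (k *: path_elt K u p + y).
    by constructor=> //; exists (u, p).
  by rewrite (path_vertex _ pw) eqxx amulDl xy -amulDl.
case/andP: qw => /eqP sev qw; exists (e :: S0); split=> [f|S uS Sv S0S].
  by rewrite inE => /orP[/eqP ->//|]; exact: S0v.
have S0S' : {subset S0 <= S} by move=> f fS0; apply: S0S; rewrite inE fS0 orbT.
have [y yP xy] := IH _ uS Sv S0S'.
exists y => //; rewrite amulDl xy amulZl -!amulA lghost_cut//.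
  by rewrite !amulx0 scaler0 add0r.
by apply: S0S; rewrite inE eqxx.
Qed.

Lemma ledge_neq0 e : ledge K e <> 0.
Proof.
move=> e0; have := lghost_ledge K e e; rewrite eqxx e0 amulx0 => /esym/eqP.
by rewrite (negPf (lvertex_neq0 _ _)).
Qed.

Lemma monomial_ledge d N x e : lspan (monomial d N.+1) x ->
  lspan (monomial (d + 1) N) (x ⊙ ledge K e).
Proof.
apply: lspan_mulr => a [v [p [u [q [w [pw qw <- qN ->]]]]]].
case: q qw qN => [|f q] /= qw qN; rewrite -amulA.
  move/eqP: qw => uw; subst u; rewrite vertex_ledge.
  case: eqP => [wse|_]; last by rewrite amulx0; exact: lspan0.
  apply: lspan_gen; exists v, (rcons p e), (range_of e), [::], (range_of e).
  have ep : is_path w [:: e] (range_of e) by rewrite /= wse !eqxx.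
  split=> //=.
  - by rewrite -cats1; apply/is_path_cat; exists w.
  - by rewrite size_rcons !subr0 -addn1 PoszD.
  - by rewrite -cats1 (path_cat pw ep) /= ledge_range -amulA ledge_range.
case/andP: qw => _ qw; rewrite -amulA lghost_ledge.
case: eqP => [ef|_]; last by rewrite !amulx0; exact: lspan0.
subst f; rewrite (ghost_vertex _ qw) eqxx.
apply: lspan_gen; exists v, p, (range_of e), q, w; split=> //.
by rewrite -(addn1 (size q)) PoszD opprD addrA subrK.
Qed.

(** If [x e <> 0] for some edge [e], then [x e] has shorter ghost parts.  Otherwise
    choose [v] with [x v <> 0]: it cannot be regular, as [v] would be the sum of the
    [e e^*].  Cutting a finite set [S] of edges at [v] does not change [x v], and
    leaves a combination of paths, whose leading coefficient is found by
    [real_leading].  An edge leaving [v] outside [S] would then not be annihilated by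
    [x], so [v] is a sink and the coefficient is a multiple of [v]. *)
Lemma monomial_reduction N d x : lspan (monomial d N) x -> x <> 0 ->
  exists u p z q w k, [/\ is_path u p w, is_path z q w, k != 0 &
    ghost_elt K u p ⊙ x ⊙ path_elt K z q = k *: lvertex K w].
Proof.
elim: N d x => [|N IH] d x xP x0.
  have [v xv0] := homog_vertex_neq0 (lspan_monomial_homog xP) x0.
  have xvP : lspan (real_elements v d) (x ⊙ lvertex K v).
    apply: lspan_mulr xP => a [u [p [z [q [w [pw qw <- + ->]]]]]].
    rewrite leqn0 => /nilP q0; subst q; move/eqP: qw => /= zw; subst z.
    rewrite -amulA vertexM; case: eqP => [wv|_]; last by rewrite amulx0; exact: lspan0.
    subst w; rewrite (path_vertex _ pw) eqxx; apply: lspan_gen.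
    by exists (u, p) => //; split=> //=; rewrite subr0.
  have [[u p] [k [[/= pv _] k0 pk]]] := real_leading xvP xv0.
  by exists u, p, v, [::], v, k; split=> //=; rewrite -amulA.
have [[e xe0]|xe0] := pselect (exists e, x ⊙ ledge K e <> 0).
  have [u [p [z [q [w [k [pw qw k0 pqk]]]]]]] := IH _ _ (monomial_ledge e xP) xe0.
  have zE : z = range_of e.
    apply: contrapT => ze; move: pqk.
    rewrite -(ledge_range K e) -!amulA (vertex_path _ qw).
    case: eqP => [ez|_]; first by case: ze.
    rewrite !amulx0 => /esym/eqP; rewrite scaler_eq0 (negPf k0).
    by rewrite (negPf (lvertex_neq0 _ _)).
  subst z; exists u, p, (source e), (e :: q), w, k; split=> //=; first by rewrite eqxx.
  by rewrite -pqk -!amulA.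
have {}xe0 e : x ⊙ ledge K e = 0.
  by apply: contrapT => xe; apply: xe0; exists e.
have [v xv0] := homog_vertex_neq0 (lspan_monomial_homog xP) x0.
have nreg s : ~ regular v s.
  move=> [s0 us sv]; apply: xv0; rewrite (vertex_regular K s0 us sv) amul_sumr.
  by rewrite big1// => e _; rewrite amulA xe0 amul0x.
have [S0 [S0v /(_ (undup S0))[]]] := monomial_cut v xP; first exact: undup_uniq.
- by move=> e; rewrite mem_undup; exact: S0v.
- by move=> e; rewrite mem_undup.
move=> y yP; set S := undup S0; have Sv e : e \in S -> source e = v.
  by rewrite mem_undup; exact: S0v.
have -> : x ⊙ cut v S = x ⊙ lvertex K v.
  rewrite amulBr amul_sumr big1 ?subr0// => e _.
  by rewrite amulA xe0 amul0x.
move=> xy; have y0 : y <> 0 by move=> y0; apply: xv0; rewrite xy y0 amul0x.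
have [[u p] [k [[/= pv _] k0 pk]]] := real_leading yP y0.
have pxv : ghost_elt K u p ⊙ x ⊙ lvertex K v = k *: cut v S.
  by rewrite -amulA xy amulA pk amulZl vertex_cut// eqxx.
have [[f sfv fS]|Sall] := pselect (exists2 f, source f = v & f \notin S).
  have := congr1 (fun z => z ⊙ ledge K f) pxv.
  rewrite -amulA -sfv source_ledge -amulA xe0 amulx0 sfv amulZl cut_ledge//.
  move=> /esym/eqP; rewrite scaler_eq0 (negPf k0) => /eqP /ledge_neq0; by [].
have S_nil : S = [::].
  apply: contrapT => /eqP S_nil; apply: (nreg S); split=> //; first exact: undup_uniq.
  move=> e; split=> [/Sv//|sev]; apply: contrapT => /negP eS.
  by apply: Sall; exists e.
exists u, p, v, [::], v, k; split=> //=.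
by rewrite pxv /cut S_nil big_nil subr0.
Qed.

Lemma homog_reduction d x : leavitt_homog K E d x -> x <> 0 ->
  exists u p z q w k, [/\ is_path u p w, is_path z q w, k != 0 &
    ghost_elt K u p ⊙ x ⊙ path_elt K z q = k *: lvertex K w].
Proof. by move=> /homog_span[N]; exact: monomial_reduction. Qed.

End Monomials.

(** * The graded socle *)

Section SpanSums.
Variables (K : fieldType) (A : nualgType K).

Lemma sums_of_lspan (S : set A) x : sums_of S x -> lspan S x.
Proof.
by move=> [s [-> sS]]; apply: lspan_sum => y /sS; exact: lspan_gen.
Qed.

Lemma lspan_sums_of (S : set A) x : (forall k y, S y -> S (k *: y)) ->
  lspan S x -> sums_of S x.
Proof.
move=> Sk; elim=> [|k a {}x Sa _ [s [-> sS]]].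
  by exists [::]; rewrite big_nil.
exists (k *: a :: s); rewrite big_cons; split=> // y.
by rewrite inE => /orP[/eqP ->|/sS//]; exact: Sk.
Qed.

End SpanSums.

Section Socle.
Variables (K : fieldType) (E : digraph).
Local Notation L := (leavitt K E).
Local Notation G := (leavitt_homog K E).
Implicit Types (u v w : vertex E) (e f : edge E) (I J : set L).

Lemma homog_decomposition (x : L) : lspan [set y | exists n, G n y] x.
Proof.
elim/leavitt_ind: x; elim=> [g||a IH|a IHa b IHb|k a IH|a IHa b IHb].
- by apply: lspan_gen; exists (gen_degree g); exact: homog_gen.
- exact: lspan0.
- by rewrite -lclassN -scaleN1r; exact: lspanZ.
- by rewrite -lclassD; exact: lspanD.
- by rewrite -lclassZ; exact: lspanZ.
- rewrite -lclassM; apply: lspan_mulr IHa => x [m xm].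
  apply: lspan_mull IHb => y [n yn]; apply: lspan_gen.
  by exists (m + n); exact: homog_mul.
Qed.

Definition principal (y : L) : set L := [set x | exists a, x = a ⊙ y].

Lemma principal_left_ideal y : left_ideal (principal y).
Proof.
split=> [|_ _ [a ->] [b ->]|b _ [a ->]]; first by exists 0; rewrite amul0x.
  by exists (a - b); rewrite amulBl.
by exists (b ⊙ a); rewrite amulA.
Qed.

Lemma principal_graded n y : G n y -> graded_left_ideal G (principal y).
Proof.
move=> yn; split; first exact: principal_left_ideal.
move=> _ [a ->]; apply: lspan_sums_of.
  move=> k z [[b ->] [m zm]]; split; first by exists (k *: b); rewrite amulZl.
  by exists m; exact: homog_scale.
apply: lspan_mulr (homog_decomposition a) => b [m bm]; apply: lspan_gen; split.
  by exists b.
by exists (m + n); exact: homog_mul.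
Qed.

Lemma graded_left_ideal_homog I : graded_left_ideal G I -> I <> [set 0] ->
  exists y n, [/\ I y, G n y & y <> 0].
Proof.
move=> [[I0 _ _] Igr] nI; apply: contrapT => ny; apply: nI.
apply/seteqP; split=> [x /Igr /sums_of_lspan xI|_ -> //].
elim: xI => //= k a {}x [Ia [n an]] _ ->; rewrite addr0.
have [->|a0] := pselect (a = 0); first by rewrite scaler0.
by case: ny; exists a, n.
Qed.

Lemma minimal_principal I w n y : minimal_graded_left_ideal G I ->
  I y -> G n y -> y <> 0 -> lvertex K w ⊙ y = y -> I = principal y.
Proof.
move=> [[[I0 IB IM] _] _ Imin] Iy yn y0 wy.
have yI : principal y `<=` I by move=> _ [a ->]; exact: IM.
have [yE|<- //] := Imin _ (principal_graded yn) yI.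
have : principal y y by exists (lvertex K w).
by rewrite yE => /y0.
Qed.

Lemma scale_vertex_neq0 (k : K) v : k != 0 -> k *: lvertex K v <> 0.
Proof.
by move=> k0 /eqP; rewrite scaler_eq0 (negPf k0) (negPf (lvertex_neq0 _ _)).
Qed.

(** Two distinct edges [e], [f] leaving a vertex [u] that [w] can reach would make
    [e^* y'] generate a proper nonzero ideal of [I], where [y'] is the transport of
    [y] to [u]. *)
Lemma minimal_unbranched I n y z q w k : minimal_graded_left_ideal G I ->
  I y -> G n y -> is_path z q w -> k != 0 -> y ⊙ path_elt K z q = k *: lvertex K w ->
  unbranched w.
Proof.
move=> Imin Iy yn qw k0 yq u [r ru] [e [f [ef seu sfu]]].
have [[[_ _ IM] _] _ _] := Imin.
pose y1 := ghost_elt K w r ⊙ y; pose b := path_elt K z q ⊙ path_elt K w r.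
have y1b : y1 ⊙ b = k *: lvertex K u.
  rewrite /y1 /b -amulA (amulA y) yq amulZl (vertex_path _ ru) eqxx.
  by rewrite amulZr (ghost_path ru).
have ey1 : lghost K e ⊙ y1 ⊙ b = k *: lghost K e.
  by rewrite -amulA y1b amulZr -seu lghost_source.
have ey0 : lghost K e ⊙ y1 <> 0.
  move=> ey0; have := congr1 (fun x => x ⊙ ledge K e) ey1.
  rewrite ey0 !amul0x amulZl lghost_ledge eqxx => /esym.
  exact: scale_vertex_neq0.
have Iy1 : I y1 by exact: IM.
have ey1_hom : G (-1 + (- (size r)%:Z + n)) (lghost K e ⊙ y1).
  apply: homog_mul; first exact: (homog_gen K (GGhost e)).
  by apply: homog_mul => //; exact: homog_ghost ru.
have IE : I = principal (lghost K e ⊙ y1).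
  apply: (@minimal_principal _ (range_of e) _ _ Imin _ ey1_hom ey0); first exact: IM.
  by rewrite amulA range_lghost.
move: Iy1; rewrite IE => -[c y1E].
have := congr1 (fun x => x ⊙ b ⊙ ledge K f) y1E.
rewrite y1b amulZl -sfu source_ledge -(amulA c) ey1 amulZr amulZl -amulA.
rewrite lghost_ledge; case: eqP => // _; rewrite amulx0 scaler0 => /eqP.
rewrite scaler_eq0 (negPf k0) => /eqP; exact: ledge_neq0.
Qed.

(** Any nonzero homogeneous element of a minimal ideal generates it; the reduction
    theorem turns one of them into [y = p^* x], which starts at a vertex [w] and has
    a multiple [y q = k w]. *)
Lemma minimal_generator I : minimal_graded_left_ideal G I ->
  exists y w, [/\ unbranched w, lvertex K w ⊙ y = y & I = principal y].
Proof.
move=> Imin; have [Igr I0 _] := Imin.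
have [x [n [Ix xn x0]]] := graded_left_ideal_homog Igr I0.
have [u [p [z [q [w [k [pw qw k0 pxq]]]]]]] := homog_reduction xn x0.
pose y := ghost_elt K u p ⊙ x; have Iy : I y by case: Igr => -[_ _ +] _; apply.
have yn : G (- (size p)%:Z + n) y by apply: homog_mul => //; exact: homog_ghost pw.
exists y, w; have wy : lvertex K w ⊙ y = y by rewrite /y amulA (vertex_ghost _ pw) eqxx.
split=> //; first exact: minimal_unbranched Imin Iy yn qw k0 pxq.
apply: (minimal_principal Imin Iy yn _ wy) => y0.
by have := @scale_vertex_neq0 k w k0; rewrite -pxq -/y y0 amul0x.
Qed.

Lemma ghost_neq0 z q w : is_path z q w -> ghost_elt K z q <> 0.
Proof.
move=> qw q0; have := ghost_path (K := K) qw; rewrite q0 amul0x => /esym/eqP.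
by rewrite (negPf (lvertex_neq0 _ _)).
Qed.

(** Any nonzero homogeneous [y] in the ideal of [q^*] gives back [q^*]: the reduction
    theorem sends [y q] to a path starting at [w], and such a path [r] is invertible
    because [r r^* = w]. *)
Lemma principal_ghost_minimal z q w : is_path z q w -> unbranched w ->
  minimal_graded_left_ideal G (principal (ghost_elt K z q)).
Proof.
move=> qw uw; have wq : lvertex K w ⊙ ghost_elt K z q = ghost_elt K z q.
  by rewrite (vertex_ghost _ qw) eqxx.
split; first exact: (principal_graded (homog_ghost K qw)).
  move=> P0; have : principal (ghost_elt K z q) (ghost_elt K z q) by exists (lvertex K w).
  by rewrite P0; exact: ghost_neq0 qw.
move=> J Jgr JP; have [->|J0] := pselect (J = [set 0]); [by left|right].
have [y [n [Jy yn y0]]] := graded_left_ideal_homog Jgr J0.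
have yqq : y ⊙ path_elt K z q ⊙ ghost_elt K z q = y.
  have [a ->] := JP _ Jy.
  by rewrite -(amulA a) (ghost_path qw) -amulA wq.
have yq0 : y ⊙ path_elt K z q <> 0 by move=> yq0; apply: y0; rewrite -yqq yq0 amul0x.
have yqn : G (n + size q) (y ⊙ path_elt K z q).
  by apply: homog_mul => //; exact: homog_path qw.
have [u [p [w' [r [w'' [k [pw rw k0 pyr]]]]]]] := homog_reduction yqn yq0.
have ww' : w = w'.
  apply: contrapT => /eqP /negPf ww'; move: (@scale_vertex_neq0 k w'' k0).
  have yqw : y ⊙ path_elt K z q = y ⊙ path_elt K z q ⊙ lvertex K w.
    by rewrite -amulA (path_vertex _ qw) eqxx.
  by rewrite -pyr yqw -!amulA (vertex_path _ rw) ww' !amulx0.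
subst w'.
have JM : forall a x, J x -> J (a ⊙ x) by case: Jgr => -[].
(* [r p^* y = k q^*], because [r p^* y q = k r r^* = k w]. *)
have Jq : J (ghost_elt K z q).
  have -> : ghost_elt K z q = k^-1 *: (path_elt K w r ⊙ ghost_elt K u p) ⊙ y; last exact: JM.
  have : path_elt K w r ⊙ ghost_elt K u p ⊙ y ⊙ path_elt K z q = k *: lvertex K w.
    transitivity (path_elt K w r ⊙
      (ghost_elt K u p ⊙ (y ⊙ path_elt K z q) ⊙ path_elt K w r) ⊙ ghost_elt K w r).
      by rewrite -!amulA (path_ghost K uw rw) (path_vertex _ qw) eqxx.
    by rewrite pyr amulZr amulZl (path_vertex _ rw) eqxx (path_ghost K uw rw).
  move=> /(congr1 (fun x => k^-1 *: (x ⊙ ghost_elt K z q))).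
  rewrite amulZl scalerA mulVf// scale1r wq => <-.
  by rewrite amulZl -!amulA (amulA y) yqq.
by apply/seteqP; split=> // _ [a ->]; exact: JM.
Qed.

(** These elements span the sum of the minimal ideals [L q^*]. *)
Definition ghost_part : set L :=
  [set x | exists a z q w, [/\ is_path z q w, unbranched w & x = a ⊙ ghost_elt K z q]].

(** Stability on the right: [q^* e] shortens [q], or, if [q] is the vertex [w], it is
    [e = e r(e)], and [r(e)] is unbranched like [w]. *)
Lemma ghost_part_gen g x : ghost_part x -> lspan ghost_part (x ⊙ lgen K g).
Proof.
move=> [a [z [q [w [qw uw ->]]]]]; rewrite -amulA.
case: g => [v|e|e].
- rewrite -/(lvertex K v) (ghost_vertex _ qw); case: eqP => _; last first.
    by rewrite amulx0; exact: lspan0.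
  by apply: lspan_gen; exists a, z, q, w.
- rewrite -/(ledge K e); case: q qw => [|f q] /=.
    move=> /eqP ->; rewrite vertex_ledge; case: eqP => [we|_]; last first.
      by rewrite amulx0; exact: lspan0.
    apply: lspan_gen; exists (a ⊙ ledge K e), (range_of e), [::], (range_of e).
    split=> //=; last by rewrite -amulA ledge_range.
    by apply: (@unbranched_path _ w [:: e]) => //=; rewrite we !eqxx.
  move=> /andP[_ qw]; rewrite -amulA lghost_ledge; case: eqP => [fe|_]; last first.
    by rewrite !amulx0; exact: lspan0.
  rewrite (ghost_vertex _ qw) eqxx; apply: lspan_gen.
  by exists a, (range_of f), q, w.
- rewrite -/(lghost K e) -(range_lghost K e) (amulA (ghost_elt _ _ _)) (ghost_vertex _ qw).
  case: eqP => [ze|_]; last by rewrite amul0x amulx0; exact: lspan0.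
  apply: lspan_gen; exists a, (source e), (e :: q), w; split=> //=.
    by rewrite eqxx -ze.
  by rewrite ze.
Qed.

Lemma ghost_part_ideal : two_sided_ideal (lspan ghost_part).
Proof.
split; first split; first exact: lspan0.
- by move=> x y xP yP; rewrite -scaleN1r; apply: lspanD => //; exact: lspanZ.
- move=> a x; apply: lspan_mull => _ [b [z [q [w [qw uw ->]]]]].
  by apply: lspan_gen; exists (a ⊙ b), z, q, w; rewrite amulA.
elim/leavitt_ind; elim=> [g||a IHa|a IHa b IHb|k a IHa|a IHa b IHb] x xP.
- by apply: lspan_mulr xP => y; exact: ghost_part_gen.
- by rewrite (_ : lclass _ = 0)// amulx0; exact: lspan0.
- by rewrite -lclassN -scaleN1r amulZr; apply/lspanZ/IHa.
- by rewrite -lclassD amulDr; apply: lspanD; [exact: IHa|exact: IHb].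
- by rewrite -lclassZ amulZr; apply/lspanZ/IHa.
- by rewrite -lclassM amulA; apply/IHb/IHa.
Qed.

Definition unbranched_vertices : set L :=
  [set x | exists v, unbranched v /\ x = lvertex K v].

Lemma socle_sub_ideal : graded_socle G `<=` ideal_generated unbranched_vertices.
Proof.
move=> x [s [-> sP]] I [[[I0 IB IM] IMr] vI].
have ID y z : I y -> I z -> I (y + z).
  by move=> Iy Iz; rewrite -[z]opprK -[- z]sub0r; apply: (IB) => //; exact: IB.
rewrite big_seq; elim/big_ind: _ => // y /sP[J Jmin].
have [z [w [uw wz ->]]] := minimal_generator Jmin; move=> [a ->].
by rewrite -wz; apply: IM; apply: IMr; apply: vI; exists w.
Qed.

Lemma ideal_sub_ghost_part :
  ideal_generated unbranched_vertices `<=` lspan ghost_part.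
Proof.
move=> x; apply; split; first exact: ghost_part_ideal.
move=> _ [v [uv ->]]; apply: lspan_gen; exists (lvertex K v), v, [::], v.
by split; rewrite /= ?eqxx ?vertex_idem.
Qed.

Lemma ghost_part_sub_socle : lspan ghost_part `<=` graded_socle G.
Proof.
move=> x xP; pose P := ghost_part.
have : sums_of P x.
  apply: lspan_sums_of xP => k _ [a [z [q [w [qw uw ->]]]]].
  by exists (k *: a), z, q, w; rewrite amulZl.
move=> [s [-> sP]]; exists s; split=> // y /sP[a [z [q [w [qw uw ->]]]]].
exists (principal (ghost_elt K z q)); last by exists a.
exact: principal_ghost_minimal qw uw.
Qed.

Lemma graded_socleE : graded_socle G = ideal_generated unbranched_vertices.
Proof.
apply/seteqP; split; first exact: socle_sub_ideal.
by move=> x /ideal_sub_ghost_part; exact: ghost_part_sub_socle.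
Qed.

Definition matrix_unit : set L :=
  [set x | exists u p z q w, [/\ is_path u p w, is_path z q w, unbranched w &
     x = path_elt K u p ⊙ ghost_elt K z q]].

(** In [p r^* q^*] the path [r] starts at the end of [q], an unbranched vertex; thus
    [(q r)^*] ends at an unbranched vertex too. *)
Lemma socle_matrix_units x : graded_socle G x -> lspan matrix_unit x.
Proof.
move=> /socle_sub_ideal /ideal_sub_ghost_part.
apply: lspan_sub => _ [a [z [q [w [qw uw ->]]]]].
apply: lspan_mulr (homog_decomposition a) => b [m /homog_span[N]].
apply: lspan_mulr => _ [v [p [u [r [t [pt rt _ _ ->]]]]]].
rewrite -(_ : lvertex K w ⊙ ghost_elt K z q = ghost_elt K z q); last first.
  by rewrite (vertex_ghost _ qw) eqxx.
rewrite amulA -(amulA (path_elt _ _ _)) (ghost_vertex _ rt); case: eqP => [uw'|_]; last first.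
  by rewrite amulx0 amul0x; exact: lspan0.
subst u; apply: lspan_gen; exists v, p, z, (q ++ r), t; split=> //.
- by apply/is_path_cat; exists w.
- exact: unbranched_path uw rt.
- by rewrite (ghost_cat qw rt) amulA.
Qed.

End Socle.

(** * Graded systems of matrix units *)

Lemma dsuppP (K : fieldType) (I : choiceType) (V : I -> lmodType K) (f : dsum V) i :
  i \in dsupp f -> f i <> 0.
Proof.
by rewrite in_fset_set; [rewrite inE /= => /eqP | exact: dval_finite].
Qed.

Section DsumMap.
Variables (K : fieldType) (I : choiceType) (V : I -> lmodType K) (W : lmodType K).
Variable F : forall i, V i -> W.
Hypothesis F_linear : forall i k x y, F (k *: x + y : V i) = k *: F x + F y.

Definition dsum_map (f : dsum V) : W := \sum_(i <- dsupp f) F (f i).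

Let F0 i : F (0 : V i) = 0.
Proof.
by have /eqP := F_linear 1 (0 : V i) 0; rewrite !scale1r addr0 addrC -subr_eq subrr => /eqP.
Qed.

(** The sum over the support is awkward when several families are compared; any finite
    set that contains the support gives the same value. *)
Lemma dsum_mapE (S : seq I) f : uniq S -> {subset dsupp f <= S} ->
  dsum_map f = \sum_(i <- S) F (f i).
Proof.
move=> uS fS; rewrite (bigID (fun i => i \in dsupp f)) /= addrC big1 ?add0r; last first.
  by move=> i /dsuppPn ->; exact: F0.
rewrite -big_filter; apply: perm_big; apply: uniq_perm.
- exact: fset_uniq.
- exact: filter_uniq.
by move=> i; rewrite mem_filter; case: (boolP (i \in dsupp f)) => // /fS ->.
Qed.

Lemma dsum_map_linear k f g : dsum_map (k *: f + g) = k *: dsum_map f + dsum_map g.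
Proof.
pose S := (dsupp f `|` dsupp g `|` dsupp (k *: f + g)%R)%fset.
rewrite !(@dsum_mapE S) ?fset_uniq//;
  try by move=> i fi; rewrite !in_fsetU fi ?orbT.
by rewrite scaler_sumr -big_split /=; apply: eq_bigr => i _; rewrite -F_linear.
Qed.

Lemma dsum_map_hits i (x : V i) : exists f, dsum_map f = F x.
Proof.
pose g j : V j := if i =P j is ReflectT ij then eq_rect i V x j ij else 0.
have g0 j : j \notin [fset i]%fset -> g j = 0.
  rewrite inE /g => /eqP ji; case: (i =P j) => // ij; case: ji; by rewrite ij.
exists (mk_dsum g0); rewrite (@dsum_mapE [:: i])//=.
  by rewrite big_seq1 /= /g; case: (i =P i) => // ii; rewrite eq_axiomK.
move=> j; apply: contraTT => ji; apply/negP => /dsuppP; rewrite /= /g.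
by case: (i =P j) => // ij; case/negP: ji; rewrite ij inE.
Qed.

End DsumMap.

Section MatrixSystem.
Variables (K : fieldType) (A : nualgType K) (I : choiceType).
Variables (Lam : I -> choiceType) (B : I -> nualgType K).
Variables (theta : forall i, B i -> A) (alpha beta : forall i, Lam i -> A).

(** The elements [alpha i s \cdot theta i b \cdot beta i t] multiply like the
    matrices with the single entry [b] in position [(s, t)] of block [i]. *)
Record matrix_system : Prop := MatrixSystem {
  ms_linear : forall i k (b c : B i),
    theta (k *: b + c) = k *: theta b + theta c;
  ms_mul : forall i (b c : B i), theta (b ⊙ c) = theta b ⊙ theta c;
  ms_unitl : forall i (s : Lam i) (b : B i), beta s ⊙ (alpha s ⊙ theta b) = theta b;
  ms_unitr : forall i (s : Lam i) (b : B i), theta b ⊙ (beta s ⊙ alpha s) = theta b;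
  ms_orth : forall i (s t : Lam i), s <> t -> beta s ⊙ alpha t = 0;
  ms_block : forall i j (s : Lam i) (t : Lam j), i <> j -> beta s ⊙ alpha t = 0 }.

Hypothesis sys : matrix_system.

Let unit_at i (st : Lam i * Lam i) (b : B i) : A :=
  alpha st.1 ⊙ theta b ⊙ beta st.2.

Let unit_at_linear i st k (b c : B i) :
  unit_at st (k *: b + c) = k *: unit_at st b + unit_at st c.
Proof. by rewrite /unit_at (ms_linear sys) amulDr amulZr amulDl amulZl. Qed.

Definition block_map i (m : fmatrix (Lam i) (B i)) : A :=
  dsum_map (V := fun=> B i) (@unit_at i) m.

Let theta0 i : theta (0 : B i) = 0.
Proof.
have /eqP := ms_linear sys 1 (0 : B i) 0.
by rewrite !scale1r addr0 addrC -subr_eq subrr => /eqP.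
Qed.

Let theta_sum i (J : Type) (r : seq J) (b : J -> B i) :
  theta (\sum_(j <- r) b j) = \sum_(j <- r) theta (b j).
Proof.
elim: r => [|j r IH]; first by rewrite !big_nil theta0.
by rewrite !big_cons -IH -[b j]scale1r (ms_linear sys) !scale1r.
Qed.

Lemma block_map_linear i k (m n : fmatrix (Lam i) (B i)) :
  block_map (k *: m + n) = k *: block_map m + block_map n.
Proof. exact: (dsum_map_linear (@unit_at_linear i)). Qed.

Lemma block_mapE i (R C : seq (Lam i)) (m : fmatrix (Lam i) (B i)) :
    uniq R -> uniq C -> {subset mrows m <= R} -> {subset mcols m <= C} ->
  block_map m = \sum_(s <- R) \sum_(t <- C) alpha s ⊙ theta (m (s, t)) ⊙ beta t.
Proof.
move=> uR uC mR mC; rewrite /block_map.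
rewrite (@dsum_mapE _ _ _ _ _ (@unit_at_linear i) [seq (s, t) | s <- R, t <- C]).
- by rewrite big_allpairs.
- by apply: allpairs_uniq => // -[? ?] [? ?].
move=> [s t] mst; apply/allpairsP; exists (s, t); split=> //=.
- by apply: mR; apply/imfsetP; exists (s, t).
- by apply: mC; apply/imfsetP; exists (s, t).
Qed.

Lemma block_mapM i (m n : fmatrix (Lam i) (B i)) :
  block_map (m ⊙ n) = block_map m ⊙ block_map n.
Proof.
have mn ij : ij \in dsupp (m ⊙ n : fmatrix _ _) ->
    (ij.1 \in mrows m) /\ (ij.2 \in mcols n).
  move=> ijmn; apply/andP; rewrite -in_fsetM; apply: contraTT ijmn => ijN.
  by apply/negP => /dsuppP; apply; exact: (fmatrix_mul_subproof ijN).
pose C := (mcols m `|` mrows n)%fset.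
rewrite (@block_mapE _ (mrows m) (mcols n) (m ⊙ n)) ?fset_uniq//; last first.
- by move=> t /imfsetP[ij /mn[_ ?] ->].
- by move=> s /imfsetP[ij /mn[? _] ->].
rewrite (@block_mapE _ (mrows m) C m) ?fset_uniq//; last first.
  by move=> t tm; rewrite in_fsetU tm.
rewrite (@block_mapE _ C (mcols n) n) ?fset_uniq//; last first.
  by move=> t tm; rewrite in_fsetU tm orbT.
rewrite amul_suml; apply: eq_bigr => s _; rewrite amul_suml.
transitivity (\sum_(v <- mcols n) \sum_(t <- C)
    alpha s ⊙ theta (m (s, t) ⊙ n (t, v)) ⊙ beta v).
  apply: eq_bigr => v _; rewrite -amul_suml -amul_sumr -theta_sum; congr (_ ⊙ theta _ ⊙ _).
  by apply: (fmatrix_mul_cols _ _ (S := C)) => t tm; rewrite in_fsetU tm.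
rewrite exchange_big /= big_seq [RHS]big_seq; apply: eq_bigr => t tC.
rewrite amul_sumr [RHS](bigD1_seq t) ?fset_uniq//= [X in _ + X]big1 ?addr0 => [|t' tt'].
  rewrite amul_sumr; apply: eq_bigr => v _; rewrite (ms_mul sys) !amulA.
  congr (_ ⊙ _); rewrite -!amulA; congr (_ ⊙ (_ ⊙ _)).
  by rewrite (ms_unitl sys).
rewrite amul_sumr big1// => v _; rewrite !amulA -(amulA _ (beta t)).
by rewrite (ms_orth sys) ?amulx0 ?amul0x// => tE; rewrite tE eqxx in tt'.
Qed.

Lemma block_map_beta i j (s : Lam i) (m : fmatrix (Lam j) (B j)) : i <> j ->
  beta s ⊙ block_map m = 0.
Proof.
move=> ij; rewrite /block_map /dsum_map amul_sumr big1// => st _.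
by rewrite /unit_at !amulA (ms_block sys)// !amul0x.
Qed.

Lemma block_map_block i j (m : fmatrix (Lam i) (B i)) (n : fmatrix (Lam j) (B j)) :
  i <> j -> block_map m ⊙ block_map n = 0.
Proof.
move=> ij; rewrite {1}/block_map /dsum_map amul_suml big1// => st _.
by rewrite /unit_at -amulA block_map_beta// amulx0.
Qed.

(** The entries of a matrix are recovered by multiplication on both sides, which makes
    the map injective and its inverse compatible with degrees. *)
Lemma block_map_coord i (s t : Lam i) (m : fmatrix (Lam i) (B i)) :
  beta s ⊙ block_map m ⊙ alpha t = theta (m (s, t)).
Proof.
pose R := (s |` mrows m)%fset; pose C := (t |` mcols m)%fset.
rewrite (@block_mapE _ R C) ?fset_uniq//; last first.
- by move=> z zm; rewrite !inE zm orbT.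
- by move=> z zm; rewrite !inE zm orbT.
rewrite amul_sumr amul_suml (bigD1_seq s) ?fset_uniq ?inE ?eqxx//=.
rewrite [X in _ + X]big1 ?addr0 => [|z zs]; last first.
  rewrite amul_sumr amul_suml big1// => y _; rewrite !amulA (ms_orth sys) ?amul0x//.
  by move=> sz; rewrite sz eqxx in zs.
rewrite amul_sumr amul_suml (bigD1_seq t) ?fset_uniq ?inE ?eqxx//=.
rewrite big1 ?addr0 => [|z zs]; last first.
  by rewrite -!amulA (ms_orth sys) ?amulx0// => zt; rewrite zt eqxx in zs.
by rewrite -!amulA (ms_unitr sys) (ms_unitl sys).
Qed.

Local Notation D := (dirsum (fun i => fmatrix (Lam i) (B i) : nualgType K)).

Definition system_map (f : D) : A :=
  dsum_map (V := fun i => fmatrix (Lam i) (B i) : lmodType K) block_map f.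

Lemma system_map_linear k f g :
  system_map (k *: f + g) = k *: system_map f + system_map g.
Proof. exact: (dsum_map_linear block_map_linear). Qed.

Lemma system_map0 : system_map 0 = 0.
Proof.
have /eqP := system_map_linear 1 0 0.
by rewrite !scale1r addr0 addrC -subr_eq subrr => /eqP.
Qed.

Lemma system_mapE (S : seq I) (f : D) : uniq S -> {subset dsupp f <= S} ->
  system_map f = \sum_(i <- S) block_map (f i).
Proof. exact: (dsum_mapE block_map_linear). Qed.

Lemma system_mapM f g : system_map (f ⊙ g) = system_map f ⊙ system_map g.
Proof.
pose S := (dsupp f `|` dsupp g `|` dsupp (f ⊙ g))%fset.
rewrite !(@system_mapE S) ?fset_uniq//;
  try by move=> i fi; rewrite !in_fsetU fi ?orbT.
rewrite amul_suml; apply: eq_big_seq => i iS.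
rewrite amul_sumr (bigD1_seq i) ?fset_uniq//= big1 ?addr0 => [|j ji].
  by rewrite -block_mapM.
by apply: block_map_block => ij; rewrite ij eqxx in ji.
Qed.

Lemma system_map_coord i (s t : Lam i) f :
  beta s ⊙ system_map f ⊙ alpha t = theta (f i (s, t)).
Proof.
pose S := (i |` dsupp f)%fset.
rewrite (@system_mapE S) ?fset_uniq//; last by move=> j jf; rewrite !inE jf orbT.
rewrite amul_sumr (bigD1_seq i) ?fset_uniq ?inE ?eqxx//= big1 ?addr0 => [|j ji].
  exact: block_map_coord.
by rewrite block_map_beta// => ij; rewrite ij eqxx in ji.
Qed.

Lemma system_map_beta (z : A) f : (forall i (s : Lam i), z ⊙ alpha s = 0) ->
  z ⊙ system_map f = 0.
Proof.
move=> z0; rewrite /system_map /dsum_map amul_sumr big1// => i _.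
rewrite /block_map /dsum_map amul_sumr big1// => st _.
by rewrite /unit_at !amulA z0 !amul0x.
Qed.

Lemma system_map_unit i (s t : Lam i) (b : B i) :
  exists f, system_map f = alpha s ⊙ theta b ⊙ beta t.
Proof.
have [m mE] := @dsum_map_hits _ _ _ _ _ (@unit_at_linear i) (s, t) b.
have [f fE] := dsum_map_hits block_map_linear (m : fmatrix (Lam i) (B i)).
by exists f; rewrite /system_map fE.
Qed.

End MatrixSystem.

Section GradedSystem.
Variables (K : fieldType) (E : digraph) (I : choiceType).
Local Notation L := (leavitt K E).
Local Notation G := (leavitt_homog K E).
Variables (Lam : I -> choiceType) (B : I -> nualgType K).
Variables (theta : forall i, B i -> L) (alpha beta : forall i, Lam i -> L).
Variables (GB : forall i, grading (B i)) (d : forall i, Lam i -> int).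

(** Besides the degrees of the parts, the coefficient map [theta] has to reflect
    degrees, and an element that is homogeneous of every degree has to vanish: this
    replaces the injectivity of [theta]. *)
Record graded_system : Prop := GradedSystem {
  gs_system : matrix_system theta alpha beta;
  gs_alpha : forall i (s : Lam i), G (d s) (alpha s);
  gs_beta : forall i (s : Lam i), G (- d s) (beta s);
  gs_homog : forall i n (b : B i), GB n b <-> G n (theta b);
  gs_separated : forall i (b : B i), (forall n, GB n b) -> b = 0 }.

Hypothesis gsys : graded_system.
Let sys := gs_system gsys.

Definition system_homog : grading (dirsum (fun i => fmatrix (Lam i) (B i) : nualgType K)) :=
  dirsum_homog (fun i => fmatrix_homog (@GB i) (@d i)).

Lemma leavitt_homog_sum n (J : eqType) (r : seq J) (F : J -> L) :
  (forall j, j \in r -> G n (F j)) -> G n (\sum_(j <- r) F j).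
Proof.
move=> rP; rewrite big_seq; elim/big_ind: _ => //; first exact: homog_zero.
by move=> x y; exact: homog_add.
Qed.

Lemma system_map_homog n f : system_homog n f -> G n (system_map theta alpha beta f).
Proof.
move=> fn; apply: leavitt_homog_sum => i _; apply: leavitt_homog_sum => -[s t] _ /=.
have -> : n = d s + (n - d s + d t) + - d t by lia.
apply: homog_mul (gs_beta gsys t); apply: homog_mul (gs_alpha gsys s) _.
exact/(gs_homog gsys)/fn.
Qed.

Lemma homog_system_map n f z : (forall i (s : Lam i), beta s ⊙ z = 0) ->
  G n (system_map theta alpha beta f + z) -> system_homog n f.
Proof.
move=> z0 fn i s t; apply/(gs_homog gsys); rewrite -(system_map_coord sys).
rewrite -[beta s ⊙ _]addr0 -(z0 i s) -amulDr.
have -> : n - d s + d t = - d s + n + d t by lia.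
apply: homog_mul (gs_alpha gsys t); exact: homog_mul (gs_beta gsys s) fn.
Qed.

Lemma system_separated f : (forall n, system_homog n f) -> f = 0.
Proof.
move=> f0; apply: dsumP => i; apply: dsumP => -[s t] /=.
apply: (gs_separated gsys) => n.
by have := f0 (n + d s - d t) i s t; rewrite (_ : _ + d t = n)//; lia.
Qed.

End GradedSystem.

Section TwoSystems.
Variables (K : fieldType) (E : digraph) (I J : choiceType).
Local Notation L := (leavitt K E).
Local Notation G := (leavitt_homog K E).
Variables (Lam : I -> choiceType) (B : I -> nualgType K).
Variables (theta : forall i, B i -> L) (alpha beta : forall i, Lam i -> L).
Variables (GB : forall i, grading (B i)) (d : forall i, Lam i -> int).
Variables (Ups : J -> choiceType) (C : J -> nualgType K).
Variables (theta' : forall j, C j -> L) (alpha' beta' : forall j, Ups j -> L).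
Variables (GC : forall j, grading (C j)) (d' : forall j, Ups j -> int).

Hypothesis gsys : graded_system theta alpha beta GB d.
Hypothesis gsys' : graded_system theta' alpha' beta' GC d'.
Hypothesis cross : forall i (s : Lam i) j (t : Ups j), beta s ⊙ alpha' t = 0.
Hypothesis cross' : forall i (s : Lam i) j (t : Ups j), beta' t ⊙ alpha s = 0.

Local Notation D := (dirsum (fun i => fmatrix (Lam i) (B i) : nualgType K)).
Local Notation D' := (dirsum (fun j => fmatrix (Ups j) (C j) : nualgType K)).

Let phi (x : D * D') : L :=
  system_map theta alpha beta x.1 + system_map theta' alpha' beta' x.2.

Let phi_linear : linear phi.
Proof.
move=> k x y; rewrite /phi /=.
rewrite (system_map_linear (gs_system gsys)) (system_map_linear (gs_system gsys')).
by rewrite scalerDr addrACA.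
Qed.

Let map0 f (y : L) : (forall i (s : Lam i), beta s ⊙ y = 0) ->
  system_map theta alpha beta f ⊙ y = 0.
Proof.
move=> y0; rewrite /system_map /dsum_map amul_suml big1// => i _.
rewrite /block_map /dsum_map amul_suml big1// => st _.
by rewrite -!amulA y0 !amulx0.
Qed.

Let map0' f (y : L) : (forall j (t : Ups j), beta' t ⊙ y = 0) ->
  system_map theta' alpha' beta' f ⊙ y = 0.
Proof.
move=> y0; rewrite /system_map /dsum_map amul_suml big1// => i _.
rewrite /block_map /dsum_map amul_suml big1// => st _.
by rewrite -!amulA y0 !amulx0.
Qed.

Let beta_map i (s : Lam i) f : beta s ⊙ system_map theta' alpha' beta' f = 0.
Proof. by apply: system_map_beta => j t; exact: cross. Qed.

Let beta_map' j (t : Ups j) f : beta' t ⊙ system_map theta alpha beta f = 0.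
Proof. by apply: system_map_beta => i s; exact: cross'. Qed.

Let phiM x y : phi (x ⊙ y) = phi x ⊙ phi y.
Proof.
rewrite /phi amulDl !amulDr (map0 _ (y := system_map theta' _ _ _)); last first.
  by move=> *; exact: beta_map.
rewrite (map0' _ (y := system_map theta _ _ _)); last by move=> *; exact: beta_map'.
rewrite addr0 add0r -(system_mapM (gs_system gsys)).
by rewrite -(system_mapM (gs_system gsys')).
Qed.

Let phi_homog n x : prod_homog (system_homog GB d) (system_homog GC d') n x <-> G n (phi x).
Proof.
split=> [[x1 x2]|xn].
  by apply: homog_add; [exact: (system_map_homog gsys)|exact: (system_map_homog gsys')].
split.
  exact: (homog_system_map gsys (fun i s => beta_map s x.2) xn).
rewrite /phi addrC in xn.
exact: (homog_system_map gsys' (fun j t => beta_map' t x.1) xn).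
Qed.

(** The map is injective because it reflects degrees: an element of its kernel is
    homogeneous of every degree. *)
Lemma graded_iso_systems (S : set L) : two_sided_ideal S ->
    (forall i (s t : Lam i) (b : B i), S (alpha s ⊙ theta b ⊙ beta t)) ->
    (forall j (s t : Ups j) (b : C j), S (alpha' s ⊙ theta' b ⊙ beta' t)) ->
    (forall x, S x -> lspan (fun y =>
      (exists i (s t : Lam i) (b : B i), y = alpha s ⊙ theta b ⊙ beta t) \/
      (exists j (s t : Ups j) (b : C j), y = alpha' s ⊙ theta' b ⊙ beta' t)) x) ->
  graded_iso G S (prod_homog (system_homog GB d) (system_homog GC d')).
Proof.
move=> [[S0 SB _] _] Sunit Sunit' Sspan.
pose f : {linear (D * D')%type -> L} :=
  HB.pack phi (GRing.isLinear.Build K _ L *:%R phi phi_linear).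
have SD x y : S x -> S y -> S (x + y).
  by move=> Sx Sy; rewrite -[y]opprK -[- y]sub0r; apply: (SB) => //; exact: SB.
have Ssum (T : eqType) (r : seq T) F : (forall j, S (F j)) -> S (\sum_(j <- r) F j).
  by move=> SF; elim/big_ind: _.
exists f; split; first exact: phiM.
- move=> x y xy; apply/eqP; rewrite -subr_eq0; apply/eqP.
  have fxy : phi (x - y) = 0 by have := linearB f x y; rewrite xy subrr.
  have xy0 n : prod_homog (system_homog GB d) (system_homog GC d') n (x - y).
    by apply/phi_homog; rewrite fxy; exact: homog_zero.
  rewrite [x - y]surjective_pairing [0 in RHS]surjective_pairing; congr (_, _).
    by apply: (system_separated gsys) => n; case: (xy0 n).
  by apply: (system_separated gsys') => n; case: (xy0 n).
- apply/seteqP; split=> [_ [x _ <-]|x /Sspan].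
    by apply: SD; apply: (Ssum) => i; apply: (Ssum) => st; [exact: Sunit|exact: Sunit'].
  elim=> [|k a {}x [[i [s [t [b ->]]]]|[j [s [t [b ->]]]]] _ [y _ <-]].
  + by exists 0 => //; rewrite linear0.
  + have [z zE] := system_map_unit (gs_system gsys) s t b.
    exists (k *: (z, 0) + y) => //; rewrite linearP /=; congr (_ *: _ + _).
    by rewrite /phi zE (system_map0 (gs_system gsys')) addr0.
  + have [z zE] := system_map_unit (gs_system gsys') s t b.
    exists (k *: (0, z) + y) => //; rewrite linearP /=; congr (_ *: _ + _).
    by rewrite /phi zE (system_map0 (gs_system gsys)) add0r.
by [].
Qed.

End TwoSystems.

(** * Paths without bifurcations *)

Section Combinatorics.
Variable E : digraph.
Implicit Types (u v w z : vertex E) (e f g : edge E) (p q r c : seq (edge E)).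

Lemma path_vertices_prefix v p w u : is_path v p w ->
  u \in path_vertices (v, p) <-> exists p1 p2, p = p1 ++ p2 /\ is_path v p1 u.
Proof.
elim: p v => [|e p IH] v /=.
  move=> _; rewrite inE; split=> [/eqP ->|[[|? ?] [p2 [//= _ /eqP ->]]]] //.
  by exists [::], [::] => /=.
move=> /andP[/eqP sev pw]; rewrite /path_vertices /= inE.
split=> [/orP[/eqP ->|/(IH _ pw)[p1 [p2 [-> p1u]]]]|[[|g p1] [p2 []]] /=].
- by exists [::], (e :: p) => /=.
- by exists (e :: p1), p2 => /=; rewrite sev eqxx.
- by move=> _ /eqP ->; rewrite eqxx.
move=> [<- pE] /andP[_ p1u]; apply/orP; right; apply/(IH _ pw).
by exists p1, p2.
Qed.

Lemma tree_source v p w e : is_path v p w -> e \in p -> tree v (source e).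
Proof.
elim: p v => [//|f p IH] v /= /andP[/eqP sfv pw]; rewrite inE => /orP[/eqP ->|ep].
  by rewrite sfv; exact: tree_refl.
by apply: (@tree_path _ v [:: f] (range_of f)); rewrite /= ?sfv ?eqxx//; exact: IH pw ep.
Qed.

(** Where no vertex bifurcates, a path is determined by its start and its length. *)
Lemma unbranched_prefix u p w q z : unbranched u -> is_path u p w -> is_path u q z ->
  (size p <= size q)%N -> exists2 r, q = p ++ r & is_path w r z.
Proof.
elim: p u q => [|e p IH] u q uu /=; first by move=> /eqP -> qz _; exists q.
case: q => [|f q] //= /andP[/eqP seu pw] /andP[/eqP sfu qz].
rewrite ltnS => spq; have ef : e = f.
  by apply: contrapT => ef; apply: (uu u (tree_refl u)); exists e, f.
subst f; have ur : unbranched (range_of e).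
  by apply: (@unbranched_path _ u [:: e]); rewrite //= seu !eqxx.
by have [r -> rz] := IH _ _ ur pw qz spq; exists r.
Qed.

Lemma not_uniq_split (T U : eqType) (h : T -> U) (s : seq T) : ~~ uniq (map h s) ->
  exists s1 x s2 y s3, s = s1 ++ x :: s2 ++ y :: s3 /\ h x = h y.
Proof.
elim: s => [//|x s IH] /=; rewrite negb_and negbK => /orP[/mapP[y ys xy]|/IH].
  by have [s2 s3] := splitPr ys; exists [::], x, s2, y, s3.
by move=> [s1 [y [s2 [z [s3 [-> yz]]]]]]; exists (x :: s1), y, s2, z, s3.
Qed.

(** Removing the detour between two visits of the same vertex shortens a closed
    path, and a closed path without repetition is a cycle. *)
Lemma closed_path_cycle w p : is_path w p w -> p <> [::] -> exists c, cycle_at w c.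
Proof.
have [n] := ubnP (size p); elim: n p => // n IH p; rewrite ltnS => pn pw p0.
have [up|nup] := boolP (uniq [seq source e | e <- p]).
  by exists p; rewrite /cycle_at pw up andbT andbT; apply/eqP.
have [s1 [x [s2 [y [s3 [pE sxy]]]]]] := not_uniq_split nup.
move: pw; rewrite pE => /is_path_cat[t s1t]; rewrite /= => /andP[/eqP sxt].
move=> /is_path_cat[t' _] /= /andP[_ s3w].
apply: (IH (s1 ++ y :: s3)); last by case: (s1).
  by move: pn; rewrite pE !size_cat /= !size_cat /=; lia.
by apply/is_path_cat; exists t; rewrite //= -sxt sxy eqxx.
Qed.

(** The edges of a closed path follow one another cyclically. *)
Lemma cycle_next w c e : is_path w c w -> e \in c ->
  exists2 g, g \in c & source g = range_of e.
Proof.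
move=> cw ec; have [c1 [c2 cE]] : exists c1 c2, c = c1 ++ e :: c2.
  by case/splitPr: ec => c1 c2; exists c1, c2.
move: (cw); rewrite cE => /is_path_cat[t c1t] /= /andP[_].
case: c2 => [|g c2] in cE * => /=.
  move=> /eqP ->; case: c cw ec cE => [//|g c] /= /andP[/eqP sgw _] _ <-.
  by exists g; rewrite ?inE ?eqxx.
by move=> /andP[/eqP sg _]; exists g => //; rewrite mem_cat !inE eqxx !orbT.
Qed.

Lemma exitless_next_unbranched w c u : is_path w c w -> ~ has_exit c ->
  (exists2 e, e \in c & range_of e = u) -> ~ bifurcation u.
Proof.
move=> cw nx [e ec eu] [f [g [fg sfu sgu]]].
have [h hc she] := cycle_next cw ec.
have [hf|hf] := eqVneq f h.
  by apply: nx; exists h, g; split=> //; [rewrite she eu | move=> gh; apply: fg; rewrite gh].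
by apply: nx; exists h, f; split=> //; [rewrite she eu | apply/eqP].
Qed.

Lemma cycle_at_path w c : cycle_at w c -> is_path w c w.
Proof. by case/and3P. Qed.

Lemma cycle_at_base w w' c : cycle_at w c -> cycle_at w' c -> w = w'.
Proof. by case: c => // e c /and3P[_ /andP[/eqP <- _] _] /and3P[_ /andP[/eqP <- _] _]. Qed.

(** The cycle and [r] are comparable, and [r] cannot be a proper part of the cycle,
    which visits [w] only once. *)
Lemma cycle_closed w c r : unbranched w -> cycle_at w c -> is_path w r w ->
  r <> [::] -> exists2 r', r = c ++ r' & is_path w r' w.
Proof.
move=> uw cw rw r0; have [cr|rc] := leqP (size c) (size r).
  exact: unbranched_prefix uw (cycle_at_path cw) rw cr.
have [c2 cE c2w] := unbranched_prefix uw rw (cycle_at_path cw) (ltnW rc).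
case: c2 cE c2w rc => [|f c2] cE; first by rewrite cE cats0 ltnn.
case: r r0 rw cE => // e r _ /= /andP[/eqP sew _] cE /andP[/eqP sfw _].
by case/and3P: cw => _ _; rewrite cE /= map_cat mem_cat /= inE sew sfw eqxx orbT.
Qed.

(** Each of the two cycles is a prefix of the other. *)
Lemma cycle_unique w c c' : unbranched w -> cycle_at w c -> cycle_at w c' -> c = c'.
Proof.
move=> uw cw cw'.
have c0 : c <> [::] by case/and3P: cw => /eqP.
have c'0 : c' <> [::] by case/and3P: cw' => /eqP.
have [r cE _] := cycle_closed uw cw (cycle_at_path cw') c'0.
have [r' c'E _] := cycle_closed uw cw' (cycle_at_path cw) c0.
have : size c = (size c + size r + size r')%N by rewrite {1}c'E cE !size_cat.
rewrite -addnA -[LHS]addn0 => /eqP; rewrite eqn_add2l eq_sym addn_eq0 => /andP[/nilP rE _].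
by rewrite cE rE cats0.
Qed.

Definition cycle_power c n : seq (edge E) := flatten (nseq n c).

Lemma cycle_powerD c m n : cycle_power c (m + n) = cycle_power c m ++ cycle_power c n.
Proof. by rewrite /cycle_power nseqD flatten_cat. Qed.

Lemma cycle_power_path w c n : is_path w c w -> is_path w (cycle_power c n) w.
Proof.
by move=> cw; elim: n => [|n IH] /=; [exact: eqxx | apply/is_path_cat; exists w].
Qed.

Lemma closed_cycle_power w c r : unbranched w -> cycle_at w c -> is_path w r w ->
  exists n, r = cycle_power c n.
Proof.
move=> uw cw; have [n] := ubnP (size r); elim: n r => // n IH r; rewrite ltnS => rn rw.
have [->|/eqP r0] := eqVneq r [::]; first by exists 0.
have [r' rE r'w] := cycle_closed uw cw rw r0.
have [|m r'E] := IH r' _ r'w; last by exists m.+1; rewrite rE r'E.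
move: rn; rewrite rE size_cat; case/and3P: cw => + _ _; case: (c) => //= e c' _.
by rewrite addSn => /(leq_ltn_trans (leq_addl _ _)).
Qed.

(** A path from [w] runs along the cycle: after removing full turns, a prefix [c1] of
    the cycle is left, and the rest [c2] of the cycle leads back to [w]. *)
Lemma cycle_reach w c r z : unbranched w -> cycle_at w c -> is_path w r z ->
  exists k c1 c2, [/\ c = c1 ++ c2, is_path w c1 z, is_path z c2 w & cycle_at z (rot k c)].
Proof.
move=> uw cw; have [n] := ubnP (size r); elim: n r => // n IH r; rewrite ltnS => rn rz.
have [cr|rc] := leqP (size c) (size r).
  have [r' rE r'z] := unbranched_prefix uw (cycle_at_path cw) rz cr.
  apply: (IH r') => //; move: rn; rewrite rE size_cat.
  by case/and3P: cw => + _ _; case: (c) => //= e c' _; lia.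
have [c2 cE c2w] := unbranched_prefix uw rz (cycle_at_path cw) (ltnW rc).
exists (size r), r, c2; split=> //; case/and3P: cw => c0 _ uc.
apply/and3P; split; first by rewrite -size_eq0 size_rot size_eq0.
  by rewrite cE rot_size_cat; apply/is_path_cat; exists w.
by rewrite map_rot rot_uniq.
Qed.

Lemma rot_closed w c k : is_path w c w ->
  exists y r, is_path w r y /\ is_path y (rot k c) y.
Proof.
rewrite -{1}(cat_take_drop k c) => /is_path_cat[y wy yw].
by exists y, (take k c); split=> //; apply/is_path_cat; exists w.
Qed.

(** A path that starts on the cycle cannot leave it, and a bifurcation on the cycle is
    an exit. *)
Lemma exitless_unbranched w c : cycle_at w c -> ~ has_exit c -> unbranched w.
Proof.
move=> cw nx z [p pz].
have on_cycle u : (exists2 e, e \in c & source e = u) -> ~ bifurcation u.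
  move=> [e ec eu] [f [g [fg sfu sgu]]]; have [fe|fe] := eqVneq f e.
    by apply: nx; exists e, g; split; rewrite ?eu// => ge; apply: fg; rewrite fe ge.
  by apply: nx; exists e, f; split; rewrite ?eu//; apply/eqP.
apply: on_cycle; elim/last_ind: p z pz => [|p f IH] z.
  move=> /= /eqP <-; case: (c) cw => // e c' /and3P[_ /andP[/eqP <- _] _].
  by exists e; rewrite ?inE ?eqxx.
rewrite -cats1 => /is_path_cat[t /IH[e ec set_] /= /andP[/eqP sft /eqP <-]].
suff <- : e = f by exact: cycle_next (cycle_at_path cw) ec.
apply: contrapT => ef; apply: nx; exists e, f; split=> //; first by rewrite set_ sft.
by move=> fe; apply: ef.
Qed.

Lemma laurent_vertex_unbranched v : laurent_vertex v -> unbranched v.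
Proof.
move=> [mu [w [c [muw munb cw nx vT]]]] u /vT; rewrite /path_vertices /= map_cat.
rewrite -cat_cons mem_cat => /orP[/munb //|/mapP[e ec ->]].
by apply: (exitless_next_unbranched (cycle_at_path cw) nx); exists e.
Qed.

(** Every path from [v] is comparable with the path [mu] to the cycle, and beyond
    [mu] it runs along the cycle. *)
Lemma unbranched_cycle_laurent v w c : unbranched v -> tree v w -> cycle_at w c ->
  laurent_vertex v.
Proof.
move=> uv [mu muw] cw; exists mu, w, c; have cp := cycle_at_path cw.
have mucw : is_path v (mu ++ c) w by apply/is_path_cat; exists w.
have uw := unbranched_path uv muw.
split=> //.
- move=> u /(path_vertices_prefix u muw)[p1 [_ [_ p1u]]].
  by apply: uv; exists p1.
- move=> [e [f [ec sfe fe]]]; apply: (uv (source e)).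
    by apply: tree_path muw _; exact: tree_source cp ec.
  by exists e, f; split=> // ef; apply: fe.
move=> u; split=> [[p pu]|/(path_vertices_prefix u mucw)[p1 [_ [_ p1u]]]]; last by exists p1.
apply/(path_vertices_prefix _ mucw).
have [pmu|/ltnW mup] := leqP (size p) (size mu).
  by have [r -> _] := unbranched_prefix uv pu muw pmu; exists p, (r ++ c); rewrite catA.
have [r pE ru] := unbranched_prefix uv muw pu mup.
have [_ [c1 [c2 [-> c1u _ _]]]] := cycle_reach uw cw ru.
by exists (mu ++ c1), c2; rewrite catA; split=> //; apply/is_path_cat; exists w.
Qed.

Lemma unbranchedE v : unbranched v <-> line_point v \/ laurent_vertex v.
Proof.
split=> [uv|[vl|]]; last 2 first.
- by move=> w /vl[].
- exact: laurent_vertex_unbranched.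
have [[w [vw [c cw]]]|nc] := pselect (exists w, tree v w /\ exists c, cycle_at w c).
  by right; exact: unbranched_cycle_laurent uv vw cw.
by left=> w vw; split; [exact: uv | move=> cw; apply: nc; exists w].
Qed.

Lemma line_point_unbranched v : line_point v -> unbranched v.
Proof. by move=> vl; apply/unbranchedE; left. Qed.

(** The longer of two such paths would continue the shorter one by a closed path,
    which contains a cycle. *)
Lemma line_point_path_uniq v p q w : line_point v -> is_path v p w -> is_path v q w ->
  p = q.
Proof.
move=> vl; have uv := line_point_unbranched vl.
wlog pq : p q / (size p <= size q)%N => [hw|] pw qw.
  by have [/hw|/ltnW /hw] := leqP (size p) (size q); [apply|move=> /(_ qw pw)].
have [r -> rw] := unbranched_prefix uv pw qw pq.
have [->|/eqP r0] := eqVneq r [::]; first by rewrite cats0.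
have [c cw] := closed_path_cycle rw r0.
have [|_ nc] := vl w; first by exists p.
by case: nc; exists c.
Qed.

(** The path is cut at its first vertex on the line of [v]. *)
Lemma line_path_split v u p w : is_path u p w -> tree v w ->
  exists p1 p2 z, [/\ p = p1 ++ p2, is_path u p1 z, is_path z p2 w, tree v z &
    forall e, e \in p1 -> ~ tree v (source e)].
Proof.
move=> + vw; elim: p u => [|e p IH] u /=.
  by move=> /eqP ->; exists [::], [::], w; split=> //=.
move=> /andP[/eqP seu pw]; have [vu|vu] := pselect (tree v u).
  by exists [::], (e :: p), u; split=> //=; rewrite seu eqxx.
have [p1 [p2 [z [-> p1z p2w vz p1v]]]] := IH _ pw.
exists (e :: p1), p2, z; split=> //=; first by rewrite seu eqxx.
by move=> f; rewrite inE => /orP[/eqP ->|/p1v//]; rewrite seu.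
Qed.

(** If [p] contains the first edge of [c], then from there on it is a power of [c];
    removing it leaves a shorter path with the same end. *)
Lemma cycle_path_split u p w c : unbranched w -> cycle_at w c -> is_path u p w ->
  exists p1 n, [/\ p = p1 ++ cycle_power c n, is_path u p1 w &
    ~ forall e, e \in c -> e \in p1].
Proof.
move=> uw cw; have [n] := ubnP (size p); elim: n p => // n IH p; rewrite ltnS => pn pw.
have [cp|cp] := pselect (forall e, e \in c -> e \in p); last first.
  by exists p, 0; rewrite cats0.
have [e [c' cE]] : exists e c', c = e :: c'.
  by case/and3P: cw => + _ _; case: (c) => // e c' _; exists e, c'.
have sew : source e = w by case/and3P: cw; rewrite cE => _ /andP[/eqP].
have ep : e \in p by apply: cp; rewrite cE inE eqxx.
case/splitPr: ep pn pw {cp} => p0 p2 pn /is_path_cat[t p0t p2w].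
have tw : t = w by case/andP: p2w => /eqP <-.
subst t; have [m p2E] := closed_cycle_power uw cw p2w.
have [|p1 [k [-> p1w p1c]]] := IH p0 _ p0t.
  by move: pn; rewrite size_cat /=; lia.
by exists p1, (k + m)%N; rewrite p2E cycle_powerD catA.
Qed.

End Combinatorics.

(** * Laurent polynomials at a cycle without exits *)

Section CyclePowers.
Variables (K : fieldType) (E : digraph) (w : vertex E) (c : seq (edge E)).
Local Notation L := (leavitt K E).
Local Notation G := (leavitt_homog K E).
Hypotheses (uw : unbranched w) (cw : cycle_at w c).

Let cp : is_path w c w := cycle_at_path cw.

Definition cpow (k : int) : L :=
  match k with
  | Posz n => path_elt K w (cycle_power c n)
  | Negz n => ghost_elt K w (cycle_power c n.+1)
  end.

Lemma cpowN (n : nat) : cpow (- n%:Z) = ghost_elt K w (cycle_power c n).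
Proof. by case: n. Qed.

Lemma vertex_cpow k : lvertex K w ⊙ cpow k = cpow k.
Proof.
case: k => n /=.
  by rewrite (vertex_path _ (cycle_power_path n cp)) eqxx.
by rewrite (vertex_ghost _ (cycle_power_path n.+1 cp)) eqxx.
Qed.

Lemma cpow_succ k : cpow (k + 1) = path_elt K w c ⊙ cpow k.
Proof.
have powS n : cycle_power c n.+1 = cycle_power c n ++ c.
  by rewrite -addn1 cycle_powerD /cycle_power /= cats0.
case: k => n.
  have -> : n%:Z + 1 = n.+1 by lia.
  by rewrite /= (path_cat cp (cycle_power_path n cp)).
have -> : Negz n + 1 = - n%:Z by lia.
rewrite cpowN /cpow powS (ghost_cat (cycle_power_path n cp) cp) amulA (path_ghost K uw cp).
by rewrite (vertex_ghost _ (cycle_power_path n cp)) eqxx.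
Qed.

Lemma cpow_pred k : cpow (k - 1) = ghost_elt K w c ⊙ cpow k.
Proof.
by rewrite -[in RHS](subrK 1 k) cpow_succ amulA (ghost_path cp) vertex_cpow.
Qed.

Lemma cpowD k l : cpow (k + l) = cpow k ⊙ cpow l.
Proof.
elim/int_rec: k => [|n IH|n IH]; first by rewrite add0r vertex_cpow.
  have -> : n.+1%:Z = n%:Z + 1 by lia.
  by rewrite -addrAC cpow_succ IH cpow_succ amulA.
have -> : - n.+1%:Z = - n%:Z - 1 by lia.
by rewrite addrAC cpow_pred IH cpow_pred amulA.
Qed.

Lemma homog_cpow k : G ((size c)%:Z * k) (cpow k).
Proof.
have sz n : size (cycle_power c n) = (size c * n)%N.
  by rewrite /cycle_power size_flatten /shape map_nseq sumn_nseq mulnC.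
case: k => n; first by rewrite -PoszM -sz; exact: homog_path (cycle_power_path n cp).
by rewrite NegzE mulrN -PoszM -sz; exact: homog_ghost (cycle_power_path n.+1 cp).
Qed.

Variable t : nat.

(** The evaluation of a Laurent polynomial at the cycle [c], whose inverse in the
    corner at [w] is [c^*]. *)
Definition laurent_eval (f : laurent K t) : L :=
  dsum_map (V := fun=> K^o) (fun k (a : K^o) => (a : K) *: cpow k) f.

Let term_linear k (a : K) (x y : K^o) :
  ((a *: x + y : K^o) : K) *: cpow k = a *: ((x : K) *: cpow k) + (y : K) *: cpow k.
Proof. by rewrite scalerDl scalerA. Qed.

Lemma laurent_eval_linear a (f g : laurent K t) :
  laurent_eval (a *: f + g) = a *: laurent_eval f + laurent_eval g.
Proof. exact: (dsum_map_linear term_linear). Qed.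

Lemma laurent_evalE (S : seq int) (f : laurent K t) : uniq S -> {subset dsupp f <= S} ->
  laurent_eval f = \sum_(k <- S) (f k : K) *: cpow k.
Proof. exact: (dsum_mapE term_linear). Qed.

Lemma laurent_evalM (f g : laurent K t) :
  laurent_eval (f ⊙ g) = laurent_eval f ⊙ laurent_eval g.
Proof.
pose N := [fset (xy.1 + xy.2)%R | xy in (dsupp f `*` dsupp g)%fset]%fset.
rewrite (@laurent_evalE N (f ⊙ g)) ?fset_uniq//; last first.
  move=> k kfg; apply: contraTT kfg => kN.
  by apply/negP => /dsuppP; apply; exact: (laurent_mul_subproof kN).
transitivity (\sum_(k <- dsupp f) \sum_(n <- N) ((f k : K) * (g (n - k) : K)) *: cpow n).
  rewrite exchange_big; apply: eq_bigr => n _ /=.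
  by rewrite (laurent_mul_left _ _ (S := dsupp f))// scaler_suml.
rewrite /laurent_eval [X in _ = X ⊙ _]/dsum_map amul_suml; apply: eq_big_seq => k kf.
rewrite -/(laurent_eval g) (@laurent_evalE [seq n - k | n <- N] g).
- rewrite big_map amul_sumr; apply: eq_bigr => n _.
  by rewrite amulZl amulZr scalerA -cpowD (addrC k) subrK.
- by rewrite map_inj_uniq ?fset_uniq//; exact: addIr.
move=> l lg; apply/mapP; exists (k + l); last by rewrite addrC addKr.
by apply/imfsetP; exists (k, l); rewrite //= in_fsetM /= kf.
Qed.

Lemma vertex_laurent_eval (f : laurent K t) : lvertex K w ⊙ laurent_eval f = laurent_eval f.
Proof.
rewrite /laurent_eval /dsum_map amul_sumr; apply: eq_bigr => k _.
by rewrite amulZr vertex_cpow.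
Qed.

Lemma laurent_eval_vertex (f : laurent K t) : laurent_eval f ⊙ lvertex K w = laurent_eval f.
Proof.
rewrite /laurent_eval /dsum_map amul_suml; apply: eq_bigr => k _.
by rewrite amulZl -[lvertex K w]/(cpow 0) -cpowD addr0.
Qed.

Lemma laurent_eval_monomial k : exists f : laurent K t, laurent_eval f = cpow k.
Proof.
have [f fE] := @dsum_map_hits _ _ _ _ _ term_linear k (1 : K^o).
by exists f; rewrite /laurent_eval fE scale1r.
Qed.

Hypothesis tE : t = size c.

Lemma size_cycle_gt0 : (0 < size c)%N.
Proof. by case/and3P: cw; rewrite -size_eq0 lt0n. Qed.

Lemma laurent_eval_homog n (f : laurent K t) : laurent_homog n f <-> G n (laurent_eval f).
Proof.
split=> [fn|fn k].
  rewrite /laurent_eval /dsum_map; apply: leavitt_homog_sum => k /dsuppP /eqP /fn <-.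
  by rewrite tE; apply: homog_scale; exact: homog_cpow.
move=> fk; apply: contrapT => /eqP tkn.
have kf : k \in dsupp f by apply: contraNT fk => /dsuppPn ->.
(* If [t k <> n], independence gives [f_k c^k u = 0] for all [u]; take [u = c^(-k)]. *)
have dinj : {in dsupp f &, injective (fun k => t%:Z * k)}.
  move=> i j _ _ /mulfI -> //; rewrite tE.
  by have := size_cycle_gt0; case: (size c).
have fhom j : j \in dsupp f -> G (t%:Z * j) ((f j : K) *: cpow j).
  by move=> _; rewrite tE; apply: homog_scale; exact: homog_cpow.
have := homog_sum_eq (fset_uniq _) dinj fhom fn erefl kf tkn (cpow (- k)).
rewrite amulZl -cpowD subrr => /eqP.
by rewrite scaler_eq0 (negPf fk) (negPf (lvertex_neq0 _ _)).
Qed.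

Lemma laurent_separated (f : laurent K t) : (forall n, laurent_homog n f) -> f = 0.
Proof.
move=> f0; apply: dsumP => k /=; apply: contrapT => /eqP fk.
by have := f0 0 _ fk; rewrite (f0 1 _ fk).
Qed.

End CyclePowers.

(** * The structure of the graded socle *)

Section Assembly.
Variables (K : fieldType) (E : digraph).
Local Notation L := (leavitt K E).
Local Notation G := (leavitt_homog K E).
Implicit Types (u v w z : vertex E) (p q : gpath E).

Lemma ghost_path_comparable p q w w' : ends_at p w -> ends_at q w' ->
  ghost_elt K p.1 p.2 ⊙ path_elt K q.1 q.2 <> 0 ->
  (exists2 r, q = (p.1, p.2 ++ r) & is_path w r w') \/
  (exists2 r, p = (q.1, q.2 ++ r) & is_path w' r w).
Proof.
case: p q => [u p] [u' q]; rewrite /ends_at /= => pw qw' /(ghost_path_neq0 pw qw')[uu'].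
subst u' => -[[r qE]|[r pE]]; [left|right]; exists r; rewrite ?qE ?pE//.
  move: qw'; rewrite qE => /is_path_cat[z pz rw'].
  by rewrite (path_end_uniq pw pz).
move: pw; rewrite pE => /is_path_cat[z qz rw].
by rewrite (path_end_uniq qw' qz).
Qed.

Section LinePaths.
Variable v : vertex E.
Hypothesis vl : line_point v.

Lemma line_pathsP q : line_paths v q ->
  [/\ tree v (path_end q), ends_at q (path_end q) &
      forall e, e \in q.2 -> ~ tree v (source e)].
Proof. by move=> [w [vw qw qv]]; rewrite (ends_at_end qw). Qed.

(** The path that defines [dist v w], so that its length is [dist v w] by
    definition. *)
Definition line_to w : seq (edge E) := xget [::] [set p | is_path v p w].

Lemma line_toP w : tree v w -> is_path v (line_to w) w.
Proof. by move=> [p pw]; rewrite /line_to; case: xgetP => // /(_ p). Qed.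

(** The ghost path brings the end of [q], anywhere on the line, back to [v]. *)
Definition line_alpha q : L := path_elt K q.1 q.2 ⊙ ghost_elt K v (line_to (path_end q)).
Definition line_beta q : L := path_elt K v (line_to (path_end q)) ⊙ ghost_elt K q.1 q.2.

Lemma line_alpha_homog q : line_paths v q -> G (line_deg v q) (line_alpha q).
Proof.
move=> /line_pathsP[/line_toP lq qq _].
by apply: homog_mul; [exact: homog_path qq | exact: homog_ghost lq].
Qed.

Lemma line_beta_homog q : line_paths v q -> G (- line_deg v q) (line_beta q).
Proof.
move=> /line_pathsP[/line_toP lq qq _]; rewrite /line_deg opprD opprK addrC.
by apply: homog_mul; [exact: homog_path lq | exact: homog_ghost qq].
Qed.

Lemma line_beta_alpha q : line_paths v q -> line_beta q ⊙ line_alpha q = lvertex K v.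
Proof.
move=> /line_pathsP[/line_toP lq qq _].
rewrite /line_beta /line_alpha -amulA (amulA (ghost_elt _ _ _)) (ghost_path qq).
by rewrite (vertex_ghost _ lq) eqxx (path_ghost K (line_point_unbranched vl) lq).
Qed.

Lemma line_alpha_vertex q : line_paths v q ->
  line_alpha q ⊙ lvertex K v = line_alpha q.
Proof.
by move=> /line_pathsP[/line_toP lq _ _]; rewrite -amulA (ghost_vertex _ lq) eqxx.
Qed.

(** An edge that continues [p] has its source on the line, which [q] avoids. *)
Lemma line_paths_comparable p q r w : line_paths v p -> line_paths v q ->
  q = (p.1, p.2 ++ r) -> is_path (path_end p) r w -> p = q.
Proof.
case: p => u p; move=> /line_pathsP[vp pp _] /line_pathsP[_ _ qv] qE rw.
case: r rw qE => [|e r] /=; first by rewrite cats0.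
move=> /andP[/eqP sep _] qE; have [] := qv e; last by rewrite sep.
by rewrite qE /= mem_cat inE eqxx orbT.
Qed.

Lemma line_paths_orthogonal p q : line_paths v p -> line_paths v q -> p <> q ->
  ghost_elt K p.1 p.2 ⊙ path_elt K q.1 q.2 = 0.
Proof.
move=> pv qv pq; have [_ pp _] := line_pathsP pv; have [_ qq _] := line_pathsP qv.
apply: contrapT => /(ghost_path_comparable pp qq)[] [r rE rp]; apply: pq.
  exact: line_paths_comparable pv qv rE rp.
by apply/esym; exact: line_paths_comparable qv pv rE rp.
Qed.

End LinePaths.

(** If [q] extends [p], then the end of [q] lies on both lines. *)
Lemma line_paths_block v v' p q : line_paths v p -> line_paths v' q ->
  ~ line_equiv v v' -> ghost_elt K p.1 p.2 ⊙ path_elt K q.1 q.2 = 0.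
Proof.
move=> /line_pathsP[vp pp _] /line_pathsP[vq qq _] nvv'.
apply: contrapT => /(ghost_path_comparable pp qq)[] [r _ rp]; apply: nvv'.
  by exists (path_end q); split=> //; move: vp => [s sp]; apply: tree_path sp _; exists r.
by exists (path_end p); split=> //; move: vq => [s sq]; apply: tree_path sq _; exists r.
Qed.

(** If [q] extends [p], then the first cycle reaches the base of the second one, so
    they differ by a rotation. *)
Lemma cycle_paths_block c c' w w' p q : cycle_at w c -> ~ has_exit c ->
  cycle_at w' c' -> ~ has_exit c' -> ends_at p w -> ends_at q w' ->
  (forall k, c' <> rot k c) -> (forall k, c <> rot k c') ->
  ghost_elt K p.1 p.2 ⊙ path_elt K q.1 q.2 = 0.
Proof.
move=> cw nx cw' nx' pw qw' ncc' nc'c.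
have uw := exitless_unbranched cw nx; have uw' := exitless_unbranched cw' nx'.
apply: contrapT => /(ghost_path_comparable pw qw')[] [r _ rp].
  have [k [? [? [_ _ _ ck]]]] := cycle_reach uw cw rp.
  by apply: (ncc' k); exact: cycle_unique uw' cw' ck.
have [k [? [? [_ _ _ ck]]]] := cycle_reach uw' cw' rp.
by apply: (nc'c k); exact: cycle_unique uw cw ck.
Qed.

(** A nonempty closed path [r] at [w] runs through the whole cycle. *)
Lemma cycle_paths_comparable c w p q r : cycle_at w c -> unbranched w ->
  is_path w r w -> (~ forall e, e \in c -> e \in q.2) ->
  q = (p.1, p.2 ++ r) -> p = q.
Proof.
move=> cw uw rw qc qE; have [r0|/eqP r0] := eqVneq r [::].
  by rewrite qE r0 cats0; case: p {qE}.
have [r' rE _] := cycle_closed uw cw rw r0.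
by case: qc => e ec; rewrite qE rE /= !mem_cat ec orbT.
Qed.

Lemma cycle_paths_orthogonal c w p q : cycle_at w c -> unbranched w ->
  ends_at p w -> ends_at q w ->
  (~ forall e, e \in c -> e \in p.2) -> (~ forall e, e \in c -> e \in q.2) ->
  p <> q -> ghost_elt K p.1 p.2 ⊙ path_elt K q.1 q.2 = 0.
Proof.
move=> cw uw pw qw pc qc pq.
apply: contrapT => /(ghost_path_comparable pw qw)[] [r rE rp]; apply: pq.
  exact: cycle_paths_comparable cw uw rp qc rE.
by apply/esym; exact: cycle_paths_comparable cw uw rp pc rE.
Qed.

(** A path through a cycle without exits never reaches the line of a line point,
    since from any vertex that the cycle reaches one comes back to the cycle. *)
Lemma line_cycle_orthogonal v c w p q : line_point v -> cycle_at w c -> unbranched w ->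
  line_paths v p -> ends_at q w ->
  ghost_elt K p.1 p.2 ⊙ path_elt K q.1 q.2 = 0 /\
  ghost_elt K q.1 q.2 ⊙ path_elt K p.1 p.2 = 0.
Proof.
move=> vl cw uw /line_pathsP[[s vp] pp _] qw.
have nvw : ~ tree v w by move=> /vl[_]; apply; exists c.
have n1 r : ~ is_path (path_end p) r w.
  by move=> rw; apply: nvw; apply: tree_path vp _; exists r.
have n2 r : ~ is_path w r (path_end p).
  move=> rp; have [k [c1 [c2 [_ _ c2w _]]]] := cycle_reach uw cw rp.
  exact: n1 c2w.
split; apply: contrapT.
  by move=> /(ghost_path_comparable pp qw)[] [r _]; [exact: n1|exact: n2].
by move=> /(ghost_path_comparable qw pp)[] [r _]; [exact: n2|exact: n1].
Qed.

Variables (X : set (vertex E)) (Y : set (seq (edge E))).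
Hypotheses (HX : line_representatives X) (HY : cycle_representatives Y).

Let X_line (v : X) : line_point (val v).
Proof. by apply: HX.1; exact: (set_valP v). Qed.
Arguments X_line : clear implicits.

Let Y_cycle (c : Y) : cycle_without_exit (val c).
Proof. by apply: HY.1; exact: (set_valP c). Qed.

Lemma X_inequivalent (v v' : X) : v <> v' -> ~ line_equiv (val v) (val v').
Proof.
move=> vv' vev'; apply: vv'; apply: val_inj.
have [u [_ uP]] := HX.2 _ (X_line v).
have eq_refl_v : line_equiv (val v) (val v).
  by exists (val v); split; exact: tree_refl.
rewrite -(uP (val v)); last by split=> //; exact: (set_valP v).
by apply: uP; split=> //; exact: (set_valP v').
Qed.

Lemma Y_not_rot (c c' : Y) k : c <> c' -> val c' <> rot k (val c).
Proof.
move=> cc' c'E; apply: cc'; apply: val_inj.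
have [d [_ dP]] := HY.2 _ (Y_cycle c).
rewrite -(dP (val c)); last by split; [exact: (set_valP c) | exists 0; rewrite rot0].
by apply: dP; split; [exact: (set_valP c') | exists k].
Qed.

Definition line_theta (v : X) (b : K^o) : L := (b : K) *: lvertex K (val v).

Lemma line_graded_system :
  graded_system (K := K) line_theta
    (fun (v : X) (q : line_paths (val v)) => line_alpha (val v) (val q))
    (fun (v : X) (q : line_paths (val v)) => line_beta (val v) (val q))
    (fun v : X => @scalar_homog K)
    (fun (v : X) (q : line_paths (val v)) => line_deg (val v) (val q)).
Proof.
have qP (v : X) (q : line_paths (val v)) : line_paths (val v) (val q) := set_valP q.
split; first split.
- by move=> v k b c; rewrite /line_theta scalerDl scalerA.
- by move=> v b c; rewrite /line_theta amulZl amulZr vertex_idem scalerA.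
- move=> v q b; rewrite amulA (line_beta_alpha (X_line v) (qP v q)).
  by rewrite /line_theta amulZr vertex_idem.
- move=> v q b; rewrite (line_beta_alpha (X_line v) (qP v q)).
  by rewrite /line_theta amulZl vertex_idem.
- move=> v p q pq; rewrite /line_beta /line_alpha -amulA (amulA (ghost_elt _ _ _)).
  rewrite (line_paths_orthogonal (qP v p) (qP v q)) ?amul0x ?amulx0//.
  by move=> /val_inj.
- move=> v v' p q vv'; rewrite /line_beta /line_alpha -amulA (amulA (ghost_elt _ _ _)).
  rewrite (line_paths_block (qP v p) (qP v' q)) ?amul0x ?amulx0//.
  exact: X_inequivalent.
- by move=> v q; exact: line_alpha_homog.
- by move=> v q; exact: line_beta_homog.
- move=> v n b; split=> [nb|bn n0].
    rewrite /line_theta; have [->|/nb ->] := eqVneq n 0.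
      exact: homog_scale (homog_gen K (GVertex (val v))).
    by rewrite scale0r; exact: homog_zero.
  have b0 : G 0 (line_theta v b) by exact: homog_scale (homog_gen K (GVertex _)).
  have dinj : {in [:: tt] &, injective (fun _ : unit => 0 : int)} by case=> -[].
  have n0' : 0 != n by rewrite eq_sym.
  have := homog_sum_eq (r := [:: tt]) erefl dinj (fun _ _ => b0) bn (big_seq1 _ _ _)
    (mem_head tt [::]) n0' (lvertex K (val v)).
  rewrite amulZl vertex_idem => /eqP.
  by rewrite scaler_eq0 (negPf (lvertex_neq0 _ _)) orbF => /eqP.
by move=> v b /(_ 1); apply.
Qed.

Definition cycle_base (c : Y) : vertex E := projT1 (cid (Y_cycle c).1).

Let cycle_baseP (c : Y) : cycle_at (cycle_base c) (val c).
Proof. exact: (projT2 (cid (Y_cycle c).1)). Qed.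

Let base_unbranched (c : Y) : unbranched (cycle_base c).
Proof. exact: exitless_unbranched (cycle_baseP c) (Y_cycle c).2. Qed.
Arguments base_unbranched : clear implicits.

Lemma cycle_pathsP (c : Y) (q : cycle_paths (val c)) : ends_at (val q) (cycle_base c) /\
  ~ forall e, e \in val c -> e \in (val q).2.
Proof.
have [w [cw qw qc]] := set_valP q; split=> //.
by rewrite -(cycle_at_base cw (cycle_baseP c)).
Qed.

Lemma cycle_graded_system :
  graded_system (K := K)
    (fun c : Y => @laurent_eval K E (cycle_base c) (val c) (size (val c)))
    (fun (c : Y) (q : cycle_paths (val c)) => path_elt K (val q).1 (val q).2)
    (fun (c : Y) (q : cycle_paths (val c)) => ghost_elt K (val q).1 (val q).2)
    (fun c : Y => @laurent_homog K (size (val c)))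
    (fun (c : Y) (q : cycle_paths (val c)) => cycle_deg (val q)).
Proof.
split; first split.
- by move=> c k f g; exact: laurent_eval_linear.
- by move=> c f g; exact: laurent_evalM.
- move=> c q f; have [qw _] := cycle_pathsP q.
  by rewrite amulA (ghost_path qw) vertex_laurent_eval.
- move=> c q f; have [qw _] := cycle_pathsP q.
  by rewrite (ghost_path qw) laurent_eval_vertex.
- move=> c p q pq; have [pw pc] := cycle_pathsP p; have [qw qc] := cycle_pathsP q.
  apply: (cycle_paths_orthogonal (cycle_baseP c) (base_unbranched c) pw qw pc qc).
  by move=> /val_inj.
- move=> c c' p q cc'; have [pw _] := cycle_pathsP p; have [qw' _] := cycle_pathsP q.
  apply: (cycle_paths_block (cycle_baseP c) (Y_cycle c).2 (cycle_baseP c')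
    (Y_cycle c').2 pw qw').
    by move=> k; exact: Y_not_rot.
  by move=> k; apply: Y_not_rot => c'c; apply: cc'.
- by move=> c q; have [qw _] := cycle_pathsP q; exact: homog_path qw.
- by move=> c q; have [qw _] := cycle_pathsP q; exact: homog_ghost qw.
- by move=> c n f; exact: laurent_eval_homog.
- by move=> c f; exact: laurent_separated.
Qed.

Lemma graded_socle_ideal : two_sided_ideal (graded_socle G).
Proof.
have -> : graded_socle G = lspan (@ghost_part K E); last exact: ghost_part_ideal.
apply/seteqP; split; last exact: ghost_part_sub_socle.
by move=> x /socle_sub_ideal /ideal_sub_ghost_part.
Qed.

Lemma socle_vertex v : unbranched v -> graded_socle G (lvertex K v).
Proof. by move=> uv; rewrite graded_socleE => I [_]; apply; exists v. Qed.

(** Both paths are cut where they first meet the line.  The remaining parts [p2] and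
    [q2] satisfy [l_p p2 = l_q q2], since there is only one path from [v] to [w];
    therefore [p2 q2^* = l_p^* l_q]. *)
Lemma line_matrix_unit v p q w : line_point v -> tree v w -> ends_at p w -> ends_at q w ->
  exists p' q', [/\ line_paths v p', line_paths v q' &
    path_elt K p.1 p.2 ⊙ ghost_elt K q.1 q.2 = line_alpha v p' ⊙ line_beta v q'].
Proof.
move=> vl vw pw qw; have uv := line_point_unbranched vl.
have [p1 [p2 [z [pE p1z p2w vz p1v]]]] := line_path_split pw vw.
have [q1 [q2 [y [qE q1y q2w vy q1v]]]] := line_path_split qw vw.
exists (p.1, p1), (q.1, q1); split.
- by exists z.
- by exists y.
rewrite pE qE (path_cat p1z p2w) (ghost_cat q1y q2w) /line_alpha /line_beta.
rewrite (ends_at_end (p1z : ends_at (p.1, p1) z)).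
rewrite (ends_at_end (q1y : ends_at (q.1, q1) y)) /=.
have [lz ly] := (line_toP vz, line_toP vy).
have uy := unbranched_path uv ly.
have lE : line_to v z ++ p2 = line_to v y ++ q2.
  by apply: (line_point_path_uniq vl (w := w)); apply/is_path_cat; [exists z|exists y].
rewrite -!amulA; congr (_ ⊙ _); rewrite !amulA; congr (_ ⊙ _).
have -> : path_elt K v (line_to v y) = path_elt K v (line_to v z ++ p2) ⊙ ghost_elt K y q2.
  rewrite lE (path_cat ly q2w) -amulA (path_ghost K uy q2w).
  by rewrite (path_vertex _ ly) eqxx.
by rewrite (path_cat lz p2w) !amulA (ghost_path lz) (vertex_path _ p2w) eqxx.
Qed.

(** Both paths end with some turns of the cycle, and [c^m] times the ghost of [c^n] is
    [c^(m - n)]. *)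
Lemma cycle_matrix_unit w c p q : unbranched w -> cycle_at w c ->
  ends_at p w -> ends_at q w ->
  exists (p' q' : gpath E) k, [/\ ends_at p' w /\ ~ (forall e, e \in c -> e \in p'.2),
    ends_at q' w /\ ~ (forall e, e \in c -> e \in q'.2) &
    path_elt K p.1 p.2 ⊙ ghost_elt K q.1 q.2 =
      path_elt K p'.1 p'.2 ⊙ cpow K w c k ⊙ ghost_elt K q'.1 q'.2].
Proof.
move=> uw cw pw qw; have cp := cycle_at_path cw.
have [p1 [m [pE p1w p1c]]] := cycle_path_split uw cw pw.
have [q1 [n [qE q1w q1c]]] := cycle_path_split uw cw qw.
exists (p.1, p1), (q.1, q1), (m%:Z - n%:Z); split=> //=.
rewrite pE qE (path_cat p1w (cycle_power_path m cp)) (ghost_cat q1w (cycle_power_path n cp)).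
by rewrite cpowD// cpowN !amulA.
Qed.

(** An unbranched vertex reaches either a representative of its class of line points
    or the base of one of the chosen cycles, and [p q^* = p r r^* q^*] for every path
    [r] from that vertex. *)
Lemma socle_systems x : graded_socle G x -> lspan (fun y =>
  (exists (v : X) (s t : line_paths (val v)) (b : K^o),
     y = line_alpha (val v) (val s) ⊙ line_theta v b ⊙ line_beta (val v) (val t)) \/
  (exists (c : Y) (s t : cycle_paths (val c)) (f : laurent K (size (val c))),
     y = path_elt K (val s).1 (val s).2 ⊙ laurent_eval (cycle_base c) (val c) f ⊙
         ghost_elt K (val t).1 (val t).2)) x.
Proof.
move=> /socle_matrix_units; apply: lspan_sub => _ [u [p [z [q [w [pw qw uw ->]]]]]].
apply: lspan_gen.
have extend r y : is_path w r y -> [/\ is_path u (p ++ r) y, is_path z (q ++ r) y &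
    path_elt K u p ⊙ ghost_elt K z q = path_elt K u (p ++ r) ⊙ ghost_elt K z (q ++ r)].
  move=> ry; split; try by apply/is_path_cat; exists w.
  rewrite (path_cat pw ry) (ghost_cat qw ry) amulA -(amulA (path_elt K u p)) (path_ghost K uw ry).
  by rewrite (path_vertex _ pw) eqxx.
have [wl|wl] := (unbranchedE w).1 uw.
  left; have [v [[Xv [y [[r ry] vy]]] _]] := HX.2 w wl.
  have [pr qr ->] := extend _ _ ry.
  pose v' : X := exist _ v (mem_set Xv).
  have [p' [q' [p'v q'v ->]]] := line_matrix_unit (X_line v' : line_point v) vy
    (pr : ends_at (u, p ++ r) y) (qr : ends_at (z, q ++ r) y).
  exists v', (exist _ p' (mem_set p'v)), (exist _ q' (mem_set q'v)), 1.
  by rewrite /line_theta scale1r /= (line_alpha_vertex p'v).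
right; have [mu [w0 [c0 [wmu _ cw0 nx0 _]]]] := wl.
have uw0 := unbranched_path uw wmu.
have [c [[Yc [k cE]] _]] := HY.2 c0 (conj (ex_intro _ w0 cw0) nx0).
pose c' : Y := exist _ c (mem_set Yc).
have cw' : cycle_at (cycle_base c') c := cycle_baseP c'.
have [y [r [w0r yc]]] := rot_closed k (cycle_at_path cw0).
have yE : y = cycle_base c'.
  apply: (@cycle_at_base _ _ _ c) => //; rewrite /cycle_at cE yc -cE.
  by case/and3P: cw' => -> _ ->.
rewrite yE in w0r; have ubase := base_unbranched c'.
have wr : is_path w (mu ++ r) (cycle_base c') by apply/is_path_cat; exists w0.
have [pr qr ->] := extend _ _ wr.
have [p' [q' [m [[p'w p'c] [q'w q'c] ->]]]] := cycle_matrix_unit ubase cw'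
  (pr : ends_at (u, p ++ (mu ++ r)) _) (qr : ends_at (z, q ++ (mu ++ r)) _).
have p'P : cycle_paths c p' by exists (cycle_base c').
have q'P : cycle_paths c q' by exists (cycle_base c').
have [f fE] := @laurent_eval_monomial K E (cycle_base c') c (size c) m.
by exists c', (exist _ p' (mem_set p'P)), (exist _ q' (mem_set q'P)), f; rewrite fE.
Qed.

Lemma graded_socle_iso : graded_iso G (graded_socle G)
  (prod_homog (@line_part_homog K E X) (@cycle_part_homog K E Y size)).
Proof.
have [Sl SR] := graded_socle_ideal; have [_ _ SM] := Sl.
apply: (graded_iso_systems line_graded_system cycle_graded_system).
- move=> v s c t; have [tw _] := cycle_pathsP t.
  have [H _] := line_cycle_orthogonal (X_line v) (cycle_baseP c) (base_unbranched c)
    (set_valP s) tw.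
  by rewrite /line_beta -amulA H amulx0.
- move=> v s c t; have [tw _] := cycle_pathsP t.
  have [_ H] := line_cycle_orthogonal (X_line v) (cycle_baseP c) (base_unbranched c)
    (set_valP s) tw.
  by rewrite /line_alpha amulA H amul0x.
- exact: graded_socle_ideal.
- move=> v s t b; apply: (SR); apply: (SM); rewrite /line_theta -vertex_idem -amulZl.
  by apply: SM; apply: socle_vertex; exact: line_point_unbranched.
- move=> c s t f; apply: (SR); apply: (SM); rewrite -vertex_laurent_eval//.
  by apply: SR; exact: socle_vertex.
- exact: socle_systems.
Qed.

End Assembly.

Theorem theorem2p10 (E : digraph) (K : fieldType) :
  graded_socle (leavitt_homog K E) =
    ideal_generated
      [set x : leavitt K E | exists v : vertex E,
         (line_point v \/ laurent_vertex v) /\ x = lvertex K v] /\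
  forall (X : set (vertex E)) (Y : set (seq (edge E))),
    line_representatives X -> cycle_representatives Y ->
    exists t : seq (edge E) -> nat,
      (forall c, Y c -> (0 < t c)%N) /\
      graded_iso (leavitt_homog K E) (graded_socle (leavitt_homog K E))
        (prod_homog (@line_part_homog K E X) (@cycle_part_homog K E Y t)).
Proof.
split.
  rewrite graded_socleE; congr ideal_generated; apply/seteqP.
  by split=> x [v [vP ->]]; exists v; split=> //; exact/unbranchedE.
move=> X Y HX HY; exists size; split; last exact: graded_socle_iso.
by move=> c /HY.1[[w cw] _]; exact: size_cycle_gt0 cw.
Qed.
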